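(* Let $\bar\lambda>0$ be as in the context and assume that $|\lambda_1|,|\lambda_2|\le\bar\lambda$ are sufficiently small so that $1-|\lambda_1|\delta>0$, $\gamma_3-|\gamma_4|\delta>0$ and $1-|\lambda_2|\delta>0$, where $\gamma_3=E_1+dE_2$ and $\gamma_4=E_1\lambda_1+dE_2\lambda_2$. Then at each step $n$ ($1\le n\le N$), given $\mathbf u_h^{n-1}\in\boldsymbol U_h$ and $\mathbf v_h^{n-1}\in\boldsymbol V_h$, the discrete system of the context has exactly one solution $(\mathbf u_h^n,\mathbf v_h^n,p_h^n)\in\boldsymbol U_h\times\boldsymbol V_h\times Q_h$.
   Context: **Continuous problem.** $\Omega\subset\mathbb R^d$, $d\in\{2,3\}$, is a bounded connected open Lipschitz polytopal domain, $T>0$. Parameters: $\alpha,\nu,\varrho>0$; $E_1>0$, $E_2<0$, $E_1-d|E_2|>0$; $\lambda_1,\lambda_2\in\mathbb R$. $\boldsymbol\varepsilon(\mathbf w)=\frac12(\nabla\mathbf w+(\nabla\mathbf w)^t)$ and $F(f)=E_1(1+\lambda_1f)-d|E_2|(1+\lambda_2f)=\gamma_3+\gamma_4f$. $V=\{\mathbf w\in H^1_0(\Omega)^d:\operatorname{div}\mathbf w=0\}$; $L^2_0(\Omega)$ is the space of mean-zero functions of $L^2(\Omega)$. Initial data $\mathbf u_0\in H^1_0(\Omega)^d$, $\mathbf v_0\in V$. The continuous problem is to find $\mathbf u$, $\mathbf v$ (divergence free), vanishing on $\partial\Omega$, and $p$ (mean zero), with $\mathbf u(0)=\mathbf u_0$,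 $\mathbf v(0)=\mathbf v_0$ and, for all $\mathbf z,\mathbf w\in H^1_0(\Omega)^d$ and a.e. $t\in]0,T[$, $$\int_\Omega\frac{\boldsymbol\varepsilon(\mathbf u):\boldsymbol\varepsilon(\mathbf z)}{E_1(1+\lambda_1\operatorname{div}\mathbf u)}+\int_\Omega\frac{|E_2|(1+\lambda_2\operatorname{div}\mathbf u)}{E_1(1+\lambda_1\operatorname{div}\mathbf u)}\frac{\operatorname{div}\mathbf u}{F(\operatorname{div}\mathbf u)}\operatorname{div}\mathbf z+\alpha\langle\partial_t\mathbf u,\mathbf z\rangle=\alpha\int_\Omega\mathbf v\cdot\mathbf z,$$ $$\langle\varrho\,\partial_t\mathbf v+\nabla p,\mathbf w\rangle+\nu\int_\Omega\nabla\mathbf v:\nabla\mathbf w+\alpha\int_\Omega\mathbf v\cdot\mathbf w=\alpha\langle\partial_t\mathbf u,\mathbf w\rangle.$$ **Standing assumption.** $\bar\lambda>0$ and $D>0$ are such that for all $|\lambda_1|,|\lambda_2|\le\bar\lambda$ the continuous problem has a solution with $\mathbf v,\mathbf u\in L^\infty(0,T;H^2(\Omega)^d)$, $\partial_t\mathbf v,\partial_t\mathbf u\in L^2(0,T;H^1(\Omega)^d)$, $\partial_{tt}^2\mathbf u\in L^2(0,T;H^{-1}(\Omega)^d)$, $p\in L^\infty(0,T;H^1(\Omega))$ and $\|\operatorname{div}\mathbf u\|_{L^\infty(0,T;L^\infty(\Omega))}\le D$. **Truncation.** A number $\delta\ge D$ is fixed, and $T_\delta f=f$ if $|f|\le\delta$,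 $T_\delta f=\delta\,\mathrm{sign}(f)$ if $|f|>\delta$. The smallness conditions in the claim guarantee that $1+\lambda_1T_\delta\operatorname{div}\mathbf w$, $F(T_\delta\operatorname{div}\mathbf w)$ and $1+\lambda_2T_\delta\operatorname{div}\mathbf w$ are bounded below by positive constants for every $\mathbf w\in H^1_0(\Omega)^d$. **Discretization.** $\boldsymbol U_h,\boldsymbol X_h\subset H^1_0(\Omega)^d$ and $Q_h\subset L^2_0(\Omega)$ are finite element (finite-dimensional) spaces with mesh size $h$; there is $\beta^*>0$ independent of $h$ with $\inf_{q\in Q_h}\sup_{\mathbf w\in\boldsymbol X_h}\frac{\int_\Omega q\operatorname{div}\mathbf w}{\|q\|_{L^2}\|\nabla\mathbf w\|_{L^2}}=\beta^*$. $\boldsymbol V_h=\{\mathbf v_h\in\boldsymbol X_h:\int_\Omega q_h\operatorname{div}\mathbf v_h=0\ \forall q_h\in Q_h\}$. **Discrete system at step $n$.** $N>1$, $\Delta t=T/N$. Given $\mathbf u_h^{n-1}\in\boldsymbol U_h$, $\mathbf v_h^{n-1}\in\boldsymbol V_h$, find $\mathbf u_h^n\in\boldsymbol U_h$, $\mathbf v_h^n\in\boldsymbol V_h$, $p_h^n\in Q_h$ such that for all $\mathbf z_h\in\boldsymbol U_h$ and all $\mathbf w_h\in\boldsymbol X_h$, $$\frac{\alpha}{\Delta t}\int_\Omega(\mathbf u_h^n-\mathbf u_h^{n-1})\cdot\mathbf z_h+\frac1{E_1}\int_\Omega\frac{\boldsymbol\varepsilon(\mathbf u_h^n):\boldsymbol\varepsilon(\mathbf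 z_h)}{1+\lambda_1T_\delta\operatorname{div}\mathbf u_h^{n-1}}+\frac{|E_2|}{E_1}\int_\Omega\frac{1+\lambda_2T_\delta\operatorname{div}\mathbf u_h^{n-1}}{1+\lambda_1T_\delta\operatorname{div}\mathbf u_h^{n-1}}\frac{(\operatorname{div}\mathbf u_h^n)(\operatorname{div}\mathbf z_h)}{F(T_\delta\operatorname{div}\mathbf u_h^{n-1})}=\alpha\int_\Omega\mathbf v_h^n\cdot\mathbf z_h,$$ $$\frac{\varrho}{\Delta t}\int_\Omega(\mathbf v_h^n-\mathbf v_h^{n-1})\cdot\mathbf w_h-\int_\Omega p_h^n\operatorname{div}\mathbf w_h+\nu\int_\Omega\nabla\mathbf v_h^n:\nabla\mathbf w_h+\alpha\int_\Omega\mathbf v_h^n\cdot\mathbf w_h=\frac{\alpha}{\Delta t}\int_\Omega(\mathbf u_h^n-\mathbf u_h^{n-1})\cdot\mathbf w_h.$$ *)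

(* Defs.v *)
From HB Require Import structures.
From mathcomp Require Import all_boot all_order all_algebra.
From mathcomp Require Import ring.
From mathcomp Require Import all_classical all_reals all_analysis.

Set Implicit Arguments.
Unset Strict Implicit.
Unset Printing Implicit Defensive.
Import Order.TTheory GRing.Theory Num.Theory.
Import numFieldNormedType.Exports.

Local Open Scope classical_set_scope.
Local Open Scope ring_scope.

(** Points of R^n are row vectors; their sigma-algebra is the product one,
    generated by the coordinates. *)

Definition rV_display : measure_display.
Proof. exact: (measure_tuple_display default_measure_display). Qed.

Section rV_measurable.
Context {R : realType} (n : nat).

Let coord (i : 'I_n) (v : 'rV[R]_n) : measurableTypeR R := v ord0 i.

Let rV_set0 : g_sigma_preimage coord set0.
Proof. exact: sigma_algebra0. Qed.

Let rV_setC A : g_sigma_preimage coord A -> g_sigma_preimage coord (~` A).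
Proof. exact: sigma_algebraC. Qed.

Let rV_bigcup (F : _^nat) : (forall i, g_sigma_preimage coord (F i)) ->
  g_sigma_preimage coord (\bigcup_i (F i)).
Proof. exact: sigma_algebra_bigcup. Qed.

HB.instance Definition _ := @isMeasurable.Build rV_display 'rV[R]_n
  (g_sigma_preimage coord) rV_set0 rV_setC rV_bigcup.

Lemma measurable_coord (i : 'I_n) :
  measurable_fun [set: 'rV[R]_n] (fun v => v ord0 i : measurableTypeR R).
Proof.
move=> _ A mA; rewrite setTI; apply: sub_sigma_algebra => /=.
rewrite -bigcup_seq/=; exists i => /=; first by rewrite mem_index_enum.
by exists A => //; rewrite setTI.
Qed.

Lemma measurable_fun_rV d (T : measurableType d) (f : T -> 'rV[R]_n) :
  (forall i, measurable_fun setT (fun x => f x ord0 i : measurableTypeR R)) ->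
  measurable_fun setT f.
Proof.
move=> mf _ A mA; rewrite setTI.
pose S := [set B : set 'rV[R]_n | measurable (f @^-1` B)].
suff : g_sigma_preimage coord `<=` S by apply.
apply: smallest_sub.
  split=> [|B SB|F SF]; rewrite /S/=.
  - by rewrite preimage_set0.
  - by rewrite setTD preimage_setC; exact: measurableC.
  - by rewrite preimage_bigcup; by apply: bigcupT_measurable.
rewrite -bigcup_seq => B [i _ [C mC <-]]; rewrite /S/= setTI.
by have := mf i measurableT C mC; rewrite setTI.
Qed.

End rV_measurable.

Section lebesgue_cons.
Context {R : realType} (n : nat).

Definition rV_cons (p : measurableTypeR R * 'rV[R]_n) : 'rV[R]_n.+1 :=
  \row_i if unlift ord0 i is Some j then p.2 ord0 j else p.1.

Lemma rV_cons0 p : rV_cons p ord0 ord0 = p.1.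
Proof. by rewrite mxE unlift_none. Qed.

Lemma rV_consS p i : rV_cons p ord0 (lift ord0 i) = p.2 ord0 i.
Proof. by rewrite mxE liftK. Qed.

Definition rV_uncons (v : 'rV[R]_n.+1) : measurableTypeR R * 'rV[R]_n :=
  (v ord0 ord0, \row_i v ord0 (lift ord0 i)).

Lemma rV_consK : cancel rV_cons rV_uncons.
Proof.
move=> -[x v]; rewrite /rV_uncons rV_cons0; congr (_, _).
by apply/rowP => i; rewrite mxE rV_consS.
Qed.

Lemma rV_unconsK : cancel rV_uncons rV_cons.
Proof.
by move=> v; apply/rowP => i; case: (unliftP ord0 i) => [j|] ->;
  rewrite ?rV_cons0 ?rV_consS ?mxE.
Qed.

Lemma measurable_rV_cons : measurable_fun setT rV_cons.
Proof.
apply: measurable_fun_rV => i; case: (unliftP ord0 i) => [j ->|->].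
  rewrite (_ : (fun _ => _) =
      (fun v : 'rV[R]_n => v ord0 j : measurableTypeR R) \o snd).
    by apply: measurableT_comp => //; exact: measurable_coord.
  by apply/funext => p; exact: rV_consS.
rewrite (_ : (fun _ => _) = fst) //.
by apply/funext => p; exact: rV_cons0.
Qed.

Lemma measurable_rV_uncons : measurable_fun setT rV_uncons.
Proof.
apply/measurable_fun_pairP; split; first exact: measurable_coord.
apply: measurable_fun_rV => i.
rewrite (_ : (fun _ => _) =
  fun v : 'rV[R]_n.+1 => v ord0 (lift ord0 i) : measurableTypeR R).
  exact: measurable_coord.
by apply/funext => v; rewrite /= mxE.
Qed.

Variable m : {sigma_finite_measure set 'rV[R]_n -> \bar R}.

Definition lebesgue_cons : set 'rV[R]_n.+1 -> \bar R :=
  pushforward (@lebesgue_measure R \x m)%E rV_cons.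

HB.instance Definition _ := Measure.copy lebesgue_cons
  (measure_function_pushforward__canonical__measure_function_Measure
    (@lebesgue_measure R \x m)%E measurable_rV_cons).

Let lebesgue_cons_sigma_finite : sigma_finite setT lebesgue_cons.
Proof.
have /sigma_finiteP[F [TF ndF Foo]] := sigma_finiteT (@lebesgue_measure R).
have /sigma_finiteP[G [TG ndG Goo]] := sigma_finiteT m.
exists (fun i => rV_uncons @^-1` (F i `*` G i)).
  apply/esym/seteqP; split => // v _.
  have [i _ Fi] : (\bigcup_i F i) (rV_uncons v).1 by rewrite -TF.
  have [j _ Gj] : (\bigcup_i G i) (rV_uncons v).2 by rewrite -TG.
  exists (maxn i j) => //; split => /=.
    by move: Fi; exact/subsetPset/ndF/leq_maxl.
  by move: Gj; exact/subsetPset/ndG/leq_maxr.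
move=> i; have [mF Fi] := Foo i; have [mG Gi] := Goo i; split.
  rewrite -[X in measurable X]setTI; apply: measurable_rV_uncons => //.
  exact: measurableX.
rewrite /lebesgue_cons /pushforward -comp_preimage.
rewrite (_ : _ \o _ = id); last by apply/funext => p; exact: rV_consK.
by rewrite preimage_id product_measure1E// lte_mul_pinfty// ge0_fin_numE.
Qed.

HB.instance Definition _ := Measure_isSigmaFinite.Build _ _ _ lebesgue_cons
  lebesgue_cons_sigma_finite.

End lebesgue_cons.

Fixpoint lebesgue_rV {R : realType} (n : nat) :
    {sigma_finite_measure set 'rV[R]_n -> \bar R} :=
  match n with
  | 0 => \d_(0 : 'rV[R]_0)
  | k.+1 => lebesgue_cons (lebesgue_rV k)
  end.

Lemma lebesgue_rV_box {R : realType} n (A : 'I_n -> set (measurableTypeR R)) :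
    (forall i, measurable (A i)) ->
  lebesgue_rV n [set v | forall i, A i (v ord0 i)] =
  (\prod_(i < n) lebesgue_measure (A i))%E.
Proof.
elim: n A => [|n IH] A mA.
  by rewrite big_ord0 /= diracE mem_set// => -[].
rewrite big_ord_recl -IH => [|i]; last exact: mA.
rewrite -product_measure1E//=; last first.
  rewrite [X in measurable X](_ : _ = \bigcap_(i in [set: 'I_n])
    ((fun v : 'rV[R]_n => v ord0 i : measurableTypeR R) @^-1` A (lift ord0 i))).
    apply: fin_bigcap_measurable => // i _; rewrite -[X in measurable X]setTI.
    by apply: measurable_coord => //; exact: mA.
  by apply/seteqP; split => v /= Av i; [move=> _; exact: Av|exact: Av].
rewrite /lebesgue_cons /pushforward; congr product_measure1.
apply/seteqP; split => -[x v] /=.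
  by move=> Av; split=> [|i]; [have := Av ord0; rewrite rV_cons0|
    have := Av (lift ord0 i); rewrite rV_consS].
by move=> [Ax Av] i; case: (unliftP ord0 i) => [j|] ->;
  rewrite ?rV_cons0 ?rV_consS.
Qed.

Section domains.
Context {R : realType} (d : nat).
Implicit Types Om : set 'rV[R]_d.

(* Near each boundary point, after an orthogonal change of coordinates y = x O,
   the domain is the strict epigraph y_k > g(y') of a Lipschitz function g of
   the remaining coordinates y' = col' k y. *)
Definition lipschitz_domain Om : Prop :=
  forall x0, (closure Om `\` Om) x0 ->
  exists (r : R) (O : 'M[R]_d) (k : 'I_d) (g : 'rV[R]_d.-1 -> R) (L : R),
    [/\ 0 < r, O *m O^T = 1%:M, L.-lipschitz g &
      forall x, ball x0 r x ->
        (Om x <-> g (col' k (x *m O)) < (x *m O) ord0 k)].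

Definition convex_hull (m : nat) (s : 'I_m -> 'rV[R]_d) : set 'rV[R]_d :=
  [set x | exists c : 'I_m -> R,
    [/\ forall i, 0 <= c i, \sum_i c i = 1 & x = \sum_i c i *: s i]].

Definition polytopal Om : Prop :=
  exists (n m : nat) (s : 'I_n -> 'I_m -> 'rV[R]_d),
    closure Om = \bigcup_(i in [set: 'I_n]) convex_hull (s i).

Definition lipschitz_polytopal_domain Om : Prop :=
  [/\ open Om, Om !=set0, connected Om & bounded_set Om] /\
  lipschitz_domain Om /\ polytopal Om.

End domains.

Section test_functions.
Context {R : realType} {V : normedModType R}.

Definition iter_derive (s : seq V) (f : V -> R) : V -> R :=
  foldr (fun v g => 'D_v g) f s.

Definition smooth (f : V -> R) : Prop :=
  forall s : seq V, continuous (iter_derive s f) /\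
    forall v x, derivable (iter_derive s f) x v.

Definition test_function (U : set V) (f : V -> R) : Prop :=
  let supp := closure [set x | f x != 0] in
  [/\ smooth f, compact supp & supp `<=` U].

End test_functions.

(** Functions are total functions on R^d of which only the values in [Om]
    matter; equality in the function spaces is equality almost everywhere in
    [Om]. *)

Section sobolev.
Context {R : realType} (d : nat) (Om : set 'rV[R]_d).

Local Notation scalar := ('rV[R]_d -> R).
Local Notation field := ('rV[R]_d -> 'rV[R]_d).
Local Notation mu := (lebesgue_rV d).
Local Notation e_ i := (delta_mx ord0 i : 'rV[R]_d).

(* Rintegral is 0 when the integral is infinite; below it is only relied upon
   for integrable functions. *)
Definition integral_on (f : scalar) : R := \int[mu]_(x in Om) f x.
Local Notation "\int_ x f" := (integral_on (fun x => f))
  (at level 36, x name, f at level 36).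

Definition L2 : set scalar := [set f : scalar |
  measurable_fun Om f /\ (\int[mu]_(x in Om) (f x ^+ 2)%:E < +oo)%E].

Definition normL2 (f : scalar) : R := Num.sqrt (\int_ x (f x ^+ 2)).

Definition L20 : set scalar := [set f : scalar | L2 f /\ \int_ x f x = 0].

Definition weak_partial (i : 'I_d) (f g : scalar) : Prop :=
  L2 g /\ forall phi, test_function Om phi ->
    \int_ x (f x * 'D_(e_ i) phi x) = - \int_ x (g x * phi x).

(* The weak partial derivative of f, defined up to a null set; a junk value
   when it does not exist in L2. *)
Definition partial (i : 'I_d) (f : scalar) : scalar :=
  xget (cst 0) [set g | weak_partial i f g].

Definition H1 : set scalar := [set f : scalar |
  L2 f /\ forall i, exists g, weak_partial i f g].

Definition normH1 (f : scalar) : R :=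
  Num.sqrt (normL2 f ^+ 2 + \sum_i normL2 (partial i f) ^+ 2).

(* The closure of the test functions in H1. *)
Definition H10 : set scalar := [set f : scalar | H1 f /\
  exists phi : nat -> scalar, [/\ forall k, test_function Om (phi k),
    normL2 (phi k \- f) @[k --> \oo] --> 0 &
    forall i, normL2 ('D_(e_ i) (phi k) \- partial i f) @[k --> \oo] --> 0]].

Definition H2 : set scalar := [set f : scalar |
  H1 f /\ forall i, H1 (partial i f)].

Definition normH2 (f : scalar) : R :=
  Num.sqrt (normL2 f ^+ 2 + \sum_i normH1 (partial i f) ^+ 2).

Definition component (w : field) (i : 'I_d) : scalar := fun x => w x ord0 i.

Definition vec (X : set scalar) : set field :=
  [set w | forall i, X (component w i)].

Definition norm_vec (N : scalar -> R) (w : field) : R :=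
  Num.sqrt (\sum_i N (component w i) ^+ 2).

Definition grad (w : field) (x : 'rV[R]_d) : 'M[R]_d :=
  \matrix_(i, j) partial j (component w i) x.

Definition div (w : field) (x : 'rV[R]_d) : R := \tr (grad w x).

Definition eps (w : field) (x : 'rV[R]_d) : 'M[R]_d :=
  2^-1 *: (grad w x + (grad w x)^T).

Definition dot (a b : 'rV[R]_d) : R := \sum_i a ord0 i * b ord0 i.

Definition ddot (A B : 'M[R]_d) : R := \sum_i \sum_j A i j * B i j.

Definition grad_scalar (q : scalar) (x : 'rV[R]_d) : 'rV[R]_d :=
  \row_i partial i q x.

Definition norm_grad (w : field) : R :=
  Num.sqrt (\int_ x ddot (grad w x) (grad w x)).

Definition V0 : set field := [set w : field |
  vec H10 w /\ ae_eq mu Om (div w) (cst 0)].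

Definition Hm1 : set (field -> R) := [set l : field -> R |
  (forall (a : R) (w z : field), vec H10 w -> vec H10 z ->
     l (a *: w + z) = a * l w + l z) /\
  exists C : R, forall w, vec H10 w -> `|l w| <= C * norm_vec normH1 w].

Definition norm_Hm1 (l : field -> R) : R :=
  sup [set `|l w| | w in [set w | vec H10 w /\ norm_vec normH1 w <= 1]].

End sobolev.

Section bochner.
Context {R : realType} (T : R).

Local Notation time := `]0, T[%classic.
Local Notation lambda := (@lebesgue_measure R).

(* X is a function space, as a set of representatives, with norm N. *)
Section spaces.
Context {E : lmodType R} (X : set E) (N : E -> R).

Definition simple_map (s : R -> E) : Prop :=
  exists (n : nat) (c : 'I_n -> E) (A : 'I_n -> set R),
    [/\ forall i, X (c i),
        forall i, measurable (A i : set (measurableTypeR R)) &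
        forall t, s t = \sum_i (\1_(A i) t : R) *: c i].

Definition strongly_measurable (u : R -> E) : Prop :=
  exists s : nat -> R -> E, (forall k, simple_map (s k)) /\
    \forall t \ae lambda, time t -> N (u t - s k t) @[k --> \oo] --> 0.

Definition Linfty_time : set (R -> E) := [set u : R -> E |
  [/\ \forall t \ae lambda, time t -> X (u t), strongly_measurable u &
    exists C : R, \forall t \ae lambda, time t -> N (u t) <= C]].

Definition L2_time : set (R -> E) := [set u : R -> E |
  [/\ \forall t \ae lambda, time t -> X (u t), strongly_measurable u &
    (\int[lambda]_(t in time) (N (u t) ^+ 2)%:E < +oo)%E]].

Definition continuous_time (u : R -> E) : Prop :=
  forall t, `[0, T]%classic t ->
    N (u s - u t) @[s --> within `[0, T]%classic (nbhs t)] --> 0.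

End spaces.

Definition weak_time_derivative (f g : R -> R) : Prop :=
  forall theta : R -> R, test_function time theta ->
    \int[lambda]_(t in time) (f t * 'D_1 theta t) =
    - \int[lambda]_(t in time) (g t * theta t).

End bochner.

Section finite_elements.
Context {R : realType} (d : nat) (Om : set 'rV[R]_d).

Local Notation scalar := ('rV[R]_d -> R).
Local Notation field := ('rV[R]_d -> 'rV[R]_d).
Local Notation mu := (lebesgue_rV d).

(* S is a set of representatives of a finite-dimensional subspace of the
   function space X. *)
Definition finite_dim_subspace (W : lmodType R) (X S : set ('rV[R]_d -> W)) :
    Prop :=
  [/\ S `<=` X, S 0, forall (a : R) f g, S f -> S g -> S (a *: f + g) &
    exists (n : nat) (b : 'I_n -> 'rV[R]_d -> W), (forall i, S (b i)) /\
      forall f, S f -> exists c : 'I_n -> R,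
        ae_eq mu Om f (\sum_i c i *: b i)].

Definition inf_sup (X : set field) (Q : set scalar) : \bar R :=
  ereal_inf [set ereal_sup
    [set (integral_on Om (fun x => q x * div Om w x) /
          (normL2 Om q * norm_grad Om w))%:E
    | w in [set w | X w /\ norm_grad Om w != 0]]
  | q in [set q | Q q /\ normL2 Om q != 0]].

Definition discretely_div_free (X : set field) (Q : set scalar) : set field :=
  [set v : field | X v /\
    forall q, Q q -> integral_on Om (fun x => q x * div Om v x) = 0].

End finite_elements.

Section model.
Context {R : realType} (d : nat) (Om : set 'rV[R]_d).
Variables (alpha nu rho E1 E2 : R).

Local Notation scalar := ('rV[R]_d -> R).
Local Notation field := ('rV[R]_d -> 'rV[R]_d).
Local Notation mu := (lebesgue_rV d).
Local Notation "\int_ x f" := (integral_on Om (fun x => f))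
  (at level 36, x name, f at level 36).
Local Notation grad := (grad Om).
Local Notation div := (div Om).
Local Notation eps := (eps Om).

Definition gamma3 : R := E1 + d%:R * E2.

Definition gamma4 (l1 l2 : R) : R := E1 * l1 + d%:R * E2 * l2.

Section continuous.
Variables (T l1 l2 : R).

Definition F (f : R) : R :=
  E1 * (1 + l1 * f) - d%:R * `|E2| * (1 + l2 * f).

Lemma F_affine f : E2 < 0 -> F f = gamma3 + gamma4 l1 l2 * f.
Proof. by move=> E2_lt0; rewrite /F /gamma3 /gamma4 ltr0_norm//; ring. Qed.

Definition stress_shear (u z : field) (x : 'rV[R]_d) : R :=
  ddot (eps u x) (eps z x) / (E1 * (1 + l1 * div u x)).

Definition stress_div (u z : field) (x : 'rV[R]_d) : R :=
  `|E2| * (1 + l2 * div u x) / (E1 * (1 + l1 * div u x)) *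
  (div u x / F (div u x)) * div z x.

(* Division by zero is total here, so that the quotients in the equation for u
   make sense has to be required of a solution. *)
Definition admissible_displacement (u : field) : Prop :=
  (\forall x \ae mu, Om x -> 1 + l1 * div u x != 0 /\ F (div u x) != 0) /\
  forall z, vec (H10 Om) z ->
    mu.-integrable Om (EFin \o stress_shear u z) /\
    mu.-integrable Om (EFin \o stress_div u z).

Definition is_dt (u du : R -> field) : Prop :=
  forall phi : field, vec (test_function Om) phi ->
    weak_time_derivative T (fun t => \int_ x (dot (u t x) (phi x)))
                           (fun t => \int_ x (dot (du t x) (phi x))).

Definition is_dt_Hm1 (du : R -> field) (ddu : R -> field -> R) : Prop :=
  forall phi : field, vec (test_function Om) phi ->
    weak_time_derivative T (fun t => \int_ x (dot (du t x) (phi x)))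
                           (fun t => ddu t phi).

Local Notation ae_time P := (\forall t \ae (@lebesgue_measure R),
  `]0, T[%classic t -> P t).

(* A solution of the continuous problem in the regularity class, with
   |div u| <= D. As du, dv and grad p are in L2, the duality brackets are
   integrals; u 0 and v 0 are the values of the L2-continuous
   representatives. *)
Record regular_solution (D : R) (u0 v0 : field)
    (u v : R -> field) (p : R -> scalar)
    (du dv : R -> field) (ddu : R -> field -> R) : Prop := RegularSolution {
  u_H2 : Linfty_time T (vec (H2 Om)) (norm_vec (normH2 Om)) u ;
  v_H2 : Linfty_time T (vec (H2 Om)) (norm_vec (normH2 Om)) v ;
  p_H1 : Linfty_time T (H1 Om) (normH1 Om) p ;
  du_H1 : L2_time T (vec (H1 Om)) (norm_vec (normH1 Om)) du ;
  dv_H1 : L2_time T (vec (H1 Om)) (norm_vec (normH1 Om)) dv ;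
  ddu_Hm1 : L2_time T (Hm1 Om) (norm_Hm1 Om) ddu ;
  du_dt : is_dt u du ;
  dv_dt : is_dt v dv ;
  ddu_dt : is_dt_Hm1 du ddu ;
  div_u_le : ae_time (fun t =>
    \forall x \ae mu, Om x -> `|div (u t) x| <= D) ;
  u_boundary : ae_time (fun t => vec (H10 Om) (u t)) ;
  v_V0 : ae_time (fun t => V0 Om (v t)) ;
  p_mean0 : ae_time (fun t => L20 Om (p t)) ;
  u_continuous : continuous_time T (norm_vec (normL2 Om)) u ;
  v_continuous : continuous_time T (norm_vec (normL2 Om)) v ;
  u_initial : ae_eq mu Om (u 0) u0 ;
  v_initial : ae_eq mu Om (v 0) v0 ;
  u_admissible : ae_time (fun t => admissible_displacement (u t)) ;
  u_equation : forall z, vec (H10 Om) z -> ae_time (fun t =>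
    \int_ x (stress_shear (u t) z x) + \int_ x (stress_div (u t) z x) +
    alpha * \int_ x (dot (du t x) (z x)) =
    alpha * \int_ x (dot (v t x) (z x))) ;
  v_equation : forall w, vec (H10 Om) w -> ae_time (fun t =>
    \int_ x (dot (rho *: dv t x + grad_scalar Om (p t) x) (w x)) +
    nu * \int_ x (ddot (grad (v t) x) (grad w x)) +
    alpha * \int_ x (dot (v t x) (w x)) =
    alpha * \int_ x (dot (du t x) (w x))) }.

End continuous.

Definition standing_assumption (T lbar D : R) (u0 v0 : field) : Prop :=
  forall l1 l2 : R, `|l1| <= lbar -> `|l2| <= lbar ->
  exists u v p du dv ddu, regular_solution T l1 l2 D u0 v0 u v p du dv ddu.

Definition truncation (delta f : R) : R :=
  if `|f| <= delta then f else delta * Num.sg f.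

Definition discrete_system (l1 l2 delta dt : R)
    (U X : set field) (Q : set scalar)
    (uold vold u v : field) (p : scalar) : Prop :=
  let tdiv := fun x => truncation delta (div uold x) in
  [/\ U u, discretely_div_free Om X Q v, Q p,
    forall z, U z ->
      alpha / dt * \int_ x (dot (u x - uold x) (z x)) +
      E1^-1 * \int_ x (ddot (eps u x) (eps z x) / (1 + l1 * tdiv x)) +
      `|E2| / E1 * \int_ x ((1 + l2 * tdiv x) / (1 + l1 * tdiv x) *
                            (div u x * div z x / F l1 l2 (tdiv x))) =
      alpha * \int_ x (dot (v x) (z x)) &
    forall w, X w ->
      rho / dt * \int_ x (dot (v x - vold x) (w x)) -
      \int_ x (p x * div w x) +
      nu * \int_ x (ddot (grad v x) (grad w x)) +
      alpha * \int_ x (dot (v x) (w x)) =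
      alpha / dt * \int_ x (dot (u x - uold x) (w x))].

End model.

(* Main.v *)
(** Modulo functions that vanish almost everywhere, the step is a square linear
    system, so it suffices that its homogeneous version is nondegenerate.
    Testing the latter with z = u / dt, w = v and q = p, the coupling terms are
    dominated by alpha |u / dt|^2 + alpha |v|^2, which gives v = 0; then z = u
    gives u = 0, without Korn's or Poincare's inequality; the inf-sup condition
    gives p = 0.
    The weak derivatives are only chosen representatives, so their linearity
    has to be recovered almost everywhere.  On H10 this does not need the
    density of test functions in L2: the defect r of linearity is orthogonal to
    all test functions, and it is itself an L2-limit of derivatives of test
    functions, which are test functions, hence r is orthogonal to itself. *)

Require Import Defs.
From mathcomp Require Import all_boot all_order all_algebra.
From mathcomp Require Import ring lra.
From mathcomp Require Import all_classical all_reals all_analysis.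
Import Order.TTheory GRing.Theory Num.Theory.
From mathcomp Require Import measurable_realfun.
Import numFieldNormedType.Exports.
Local Open Scope classical_set_scope.
Local Open Scope ring_scope.
Set Implicit Arguments.
Unset Strict Implicit.
Unset Printing Implicit Defensive.

(** * Lebesgue measure on Euclidean space *)

Section borel_rV.
Context {R : realType} (n : nat).

Lemma measurable_rV_box (A : 'I_n -> set R) : (forall i, measurable (A i)) ->
  measurable [set v : 'rV[R]_n | forall i, A i (v ord0 i)].
Proof.
move=> mA; rewrite [X in measurable X](_ : _ = \bigcap_(i in [set: 'I_n])
  ((fun v : 'rV[R]_n => v ord0 i : measurableTypeR R) @^-1` A i)).
  apply: fin_bigcap_measurable => // i _; rewrite -[X in measurable X]setTI.
  by apply: measurable_coord => //; exact: mA.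
by apply/seteqP; split => v /= Av i; [move=> _; exact: Av|exact: Av].
Qed.

Lemma ball_rVE (x y : 'rV[R]_n) e : 0 < e ->
  ball x e y <-> forall i, ball (x ord0 i) e (y ord0 i).
Proof.
move=> e0; split=> [[_ xy] i|xy]; first exact: xy.
by split=> // i j; rewrite (ord1 i); exact: xy.
Qed.

(* The balls of R^n are boxes for the maximum norm, so an open set is a
   countable union of boxes with rational centres. *)
Lemma open_measurable_rV (A : set 'rV[R]_n) : open A -> measurable A.
Proof.
move=> oA.
pose box (p : 'rV[rat]_n * nat) : set 'rV[R]_n :=
  [set v | forall i, ball (ratr (p.1 ord0 i) : R) p.2.+1%:R^-1 (v ord0 i)].
have -> : A = \bigcup_p (if pselect (box p `<=` A) then box p else set0).
  apply/seteqP; split=> [x Ax|x [p _]]; last by case: pselect => // pA /pA.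
  have /nbhs_ballP[e /= e0 eA] : nbhs x A by exact: open_nbhs_nbhs.
  (* Half of [e]: a point of the box reaches [x] through the rational centre, at the cost of two
     radii. *)
  have [k ke] : exists k, k.+1%:R^-1 < e / 2 :> R.
    have /ltr_add_invr[k] : 0 < e / 2 by rewrite divr_gt0.
    by rewrite add0r => ?; exists k.
  have k0 : 0 < k.+1%:R^-1 :> R by rewrite invr_gt0 ltr0n.
  have cl i : exists q : rat, ball (ratr q : R) k.+1%:R^-1 (x ord0 i).
    have /rat_in_itvoo[q] : x ord0 i - k.+1%:R^-1 < x ord0 i by rewrite ltrBlDr ltrDl.
    rewrite in_itv/= => /andP[q1 q2]; exists q.
    by rewrite /ball/= ltr_norml; move: k0 q1 q2; set r := _^-1; move=> *; apply/andP; split; lra.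
  have [q xq] := choice cl.
  exists (\row_i q i, k) => //; case: pselect => [?|]; first by move=> i /=; rewrite mxE.
  case=> y /= yb; apply: eA; apply/ball_rVE => // i.
  have := yb i; rewrite mxE => yi; have xi := xq i.
  rewrite (splitr e); apply: (ball_triangle (le_ball (ltW ke) _)
    (le_ball (ltW ke) yi)).
  exact: ball_sym.
apply: countable_bigcupT_measurable; first exact: countableP.
move=> p; case: pselect => //= _.
apply: (@measurable_rV_box (fun i => ball (ratr (p.1 ord0 i) : R) _)) => i.
by apply: open_measurable; exact: ball_open.
Qed.

Lemma continuous_measurable_rV (f : 'rV[R]_n -> R) :
  continuous f -> measurable_fun setT f.
Proof.
move=> /continuousP cf; apply: (measurability _ (RGenOpens.measurableE R)).
move=> _ [_ [a [b ->] <-]]; rewrite setTI; apply: open_measurable_rV.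
exact/cf/interval_open.
Qed.

(** A bounded set lies in a cube, whose measure is a finite product of finite lengths. *)
Lemma bounded_lebesgue_rV_lty (A : set 'rV[R]_n) :
  measurable A -> bounded_set A -> (lebesgue_rV n A < +oo)%E.
Proof.
move=> mA [N [_ /(_ (N + 1))]]; rewrite ltrDl ltr01 => /(_ isT).
set M := N + 1 => MA.
pose I : set (measurableTypeR R) := `[- M, M]%classic.
have sub : A `<=` [set v : 'rV[R]_n | forall i, I (v ord0 i)].
  move=> v /MA vM i; rewrite /I/= in_itv/= -ler_norml; apply: le_trans vM.
  by rewrite [leRHS]/Num.norm /= mx_normrE; apply/bigmax_geP; right; exists (ord0, i).
apply: (@le_lt_trans _ _ (lebesgue_rV n [set v : 'rV[R]_n | forall i, I (v ord0 i)])).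
  apply: le_measure => //; rewrite ?inE //.
  by apply: (@measurable_rV_box (fun=> I)) => i; exact: measurable_itv.
rewrite (@lebesgue_rV_box R n (fun=> I)); last by move=> i; exact: measurable_itv.
have : lebesgue_measure I \is a fin_num.
  rewrite /I lebesgue_measure_itv; case: ifPn => // _.
move=> fI; rewrite -ge0_fin_numE; last by apply: prode_ge0.
by apply: (big_ind (fun x : \bar R => x \is a fin_num)) => // x y; exact: fin_numM.
Qed.

End borel_rV.

(** * Weighted products on L2 *)

Section L2_theory.
Context {R : realType} (d : nat) (Om : set 'rV[R]_d).
Hypothesis mOm : measurable Om.
Implicit Types f g h k : 'rV[R]_d -> R.

Local Notation mu := (lebesgue_rV d).

(** Coefficients for which the product with two L2 functions is integrable; no sign is imposed, so
    positivity is a separate matter. *)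
Definition weight k :=
  measurable_fun Om k /\ exists M, forall x, Om x -> `|k x| <= M.

Definition wip k f g := integral_on Om (fun x => k x * (f x * g x)).

Lemma weight_cst c : weight (cst c).
Proof. by split; [exact: measurable_cst|exists `|c|]. Qed.

Lemma L2_sqr_integrable f : L2 Om f -> mu.-integrable Om (EFin \o (fun x => f x ^+ 2)).
Proof.
move=> [mf fi]; apply/integrableP; split.
  by apply/measurable_EFinP; exact: measurable_funX.
rewrite (eq_integral (fun x => (f x ^+ 2)%:E)) // => x _.
by rewrite /= ger0_norm ?sqr_ge0.
Qed.

(** Domination by [M * (f ^+ 2 + g ^+ 2)], which follows from the square of [|f| - |g|] being
    nonnegative. *)
Lemma L2_mul_integrable k f g : weight k -> L2 Om f -> L2 Om g ->
  mu.-integrable Om (EFin \o (fun x => k x * (f x * g x))).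
Proof.
move=> [mk [M kM]] Lf Lg.
apply: (@le_integrable _ _ _ _ _ mOm _
  (EFin \o (fun x => M * (f x ^+ 2 + g x ^+ 2)))).
- apply/measurable_EFinP; apply: measurable_funM => //.
  by apply: measurable_funM; [case: Lf|case: Lg].
- move=> x /kM kx /=; rewrite lee_fin normrM.
  have M0 : 0 <= M by exact: le_trans kx.
  rewrite [leRHS]ger0_norm ?mulr_ge0 ?addr_ge0 ?sqr_ge0//.
  apply: ler_pM => //; rewrite normrM -(real_normK (num_real (f x))).
  rewrite -(real_normK (num_real (g x))).
  have := sqr_ge0 (`|f x| - `|g x|); have := normr_ge0 (f x); have := normr_ge0 (g x).
  by nra.
- rewrite (_ : _ \o _ = (fun x => M%:E * ((EFin \o (fun x => f x ^+ 2)%R) \+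
     (EFin \o (fun x => g x ^+ 2)%R)) x)%E); last by apply/funext.
  by apply: integrableZl => //; apply: integrableD => //; exact: L2_sqr_integrable.
Qed.

(** The square is dominated by twice the sum of the squares of [a f] and [g]; the gap is the square
    of [a f - g]. *)
Lemma L2_lin a f g : L2 Om f -> L2 Om g -> L2 Om (a *: f + g).
Proof.
move=> Lf Lg; split.
  apply: measurable_funD; last by case: Lg.
  by apply: measurable_funM; [exact: measurable_cst|case: Lf].
have If := L2_sqr_integrable Lf; have Ig := L2_sqr_integrable Lg.
have : mu.-integrable Om (EFin \o (fun x => (a *: f + g) x ^+ 2)).
  apply: (@le_integrable _ _ _ _ _ mOm _
    (fun x => (2 * a ^+ 2)%:E * (EFin \o (fun x => f x ^+ 2)%R) x +
              2%:E * (EFin \o (fun x => g x ^+ 2)%R) x)%E).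
  - apply/measurable_EFinP; apply: measurable_funX.
    apply: measurable_funD; last by case: Lg.
    by apply: measurable_funM; [exact: measurable_cst|case: Lf].
  - move=> x _ /=; rewrite lee_fin !ger0_norm ?sqr_ge0//; last first.
      by rewrite addr_ge0// mulr_ge0 ?sqr_ge0// mulr_ge0 ?sqr_ge0.
    rewrite (_ : (a *: f + g) x = a * f x + g x) //.
    by have := sqr_ge0 (a * f x - g x); nra.
  - by apply: integrableD => //; exact: integrableZl.
move=> /integrableP[_].
rewrite (eq_integral (fun x => ((a *: f + g) x ^+ 2)%:E)) // => x _.
by rewrite /= ger0_norm ?sqr_ge0.
Qed.

Lemma L2_0 : L2 Om 0.
Proof.
split; first exact: (measurable_cst (0 : R)).
by rewrite integral0_eq ?ltry// => x _ /=; rewrite expr0n.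
Qed.

Lemma wipC k f g : wip k f g = wip k g f.
Proof. by congr (integral_on _ _); apply/funext => x; rewrite [f x * _]mulrC. Qed.

Lemma wip_linl k a f g h : weight k -> L2 Om f -> L2 Om g -> L2 Om h ->
  wip k (a *: f + g) h = a * wip k f h + wip k g h.
Proof.
move=> wk Lf Lg Lh; rewrite /wip /integral_on.
have If := L2_mul_integrable wk Lf Lh.
rewrite -RintegralZl// -RintegralD//; last 2 first.
- rewrite (_ : _ \o _ = fun x => a%:E * (EFin \o (fun x => k x * (f x * h x))%R) x)%E.
    exact: integrableZl.
  by apply/funext.
- exact: L2_mul_integrable.
congr Rintegral; apply/funext => x; rewrite (_ : (a *: f + g) x = a * f x + g x) //; ring.
Qed.

Lemma wip_linr k a f g h : weight k -> L2 Om f -> L2 Om g -> L2 Om h ->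
  wip k h (a *: f + g) = a * wip k h f + wip k h g.
Proof. by move=> *; rewrite ![wip k h _]wipC wip_linl. Qed.

Lemma wip0l k g : weight k -> L2 Om g -> wip k 0 g = 0.
Proof.
move=> wk Lg; have := wip_linl 1 wk L2_0 L2_0 Lg.
by rewrite scale1r addr0 mul1r -{1}[wip k 0 g]addr0 => /addrI.
Qed.

Lemma integral_on_ae f g : measurable_fun Om f -> measurable_fun Om g ->
  ae_eq mu Om f g -> integral_on Om f = integral_on Om g.
Proof.
move=> mf mg fg; rewrite /integral_on /Rintegral; congr fine.
apply: ae_eq_integral => //; [exact/measurable_EFinP|exact/measurable_EFinP|].
by apply: filterS fg => x /= fg /fg ->.
Qed.

Lemma wip_ae k f f' g g' : weight k -> L2 Om f -> L2 Om f' -> L2 Om g -> L2 Om g' ->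
  ae_eq mu Om f f' -> ae_eq mu Om g g' -> wip k f g = wip k f' g'.
Proof.
move=> [mk _] [mf _] [mf' _] [mg _] [mg' _] ff' gg'.
apply: integral_on_ae; try by apply: measurable_funM => //; exact: measurable_funM.
by apply: filterS2 ff' gg' => x ff' gg' Ox; rewrite ff'// gg'.
Qed.

Lemma wip_ge0 k f : (forall x, Om x -> 0 <= k x) -> 0 <= wip k f f.
Proof.
move=> k0; apply: Rintegral_ge0 => x Ox; apply: mulr_ge0; first exact: k0.
by rewrite -expr2 sqr_ge0.
Qed.

Lemma normL2_wip f : normL2 Om f ^+ 2 = wip (cst 1) f f.
Proof.
rewrite sqr_sqrtr; last by apply: Rintegral_ge0 => x _; rewrite sqr_ge0.
by congr (integral_on _ _); apply/funext => x; rewrite /= mul1r expr2.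
Qed.

Lemma wip_eq0 f : L2 Om f -> wip (cst 1) f f = 0 -> ae_eq mu Om f (cst 0).
Proof.
move=> Lf; have If := L2_sqr_integrable Lf; rewrite /wip /integral_on => f0.
have mf2 : measurable_fun Om (EFin \o (fun x => f x ^+ 2)) by case/integrableP: If.
have /(ae_eq_integral_abs mu mOm mf2) : (\int[mu]_(x in Om) `|(EFin \o (fun x => f x ^+ 2)%R) x| = 0)%E.
  rewrite (eq_integral (EFin \o (fun x => f x ^+ 2))); last first.
    by move=> x _ /=; rewrite ger0_norm ?sqr_ge0.
  (* Integrability rules out that the real integral is 0 merely as the default value for an infinite
     one. *)
  rewrite -[LHS]fineK; last exact: integrable_fin_num.
  congr EFin; rewrite -[RHS]f0; congr fine; apply: eq_integral => x _ /=.
  by rewrite mul1r expr2.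
apply: filterS => x /= xf /xf [] /eqP.
by rewrite sqrf_eq0 => /eqP.
Qed.

(** The squared norm of [a *: f + g] is a nonnegative quadratic polynomial in [a]; its value at the
    minimiser gives the bound. If [f] has norm 0, it vanishes almost everywhere and so does the
    product. *)
Lemma wip_cauchy_schwarz f g : L2 Om f -> L2 Om g ->
  `|wip (cst 1) f g| <= normL2 Om f * normL2 Om g.
Proof.
move=> Lf Lg; have w1 := weight_cst 1.
have L0 := L2_0.
have key a : 0 <= a ^+ 2 * wip (cst 1) f f + 2 * a * wip (cst 1) f g + wip (cst 1) g g.
  have : 0 <= wip (cst 1) (a *: f + g) (a *: f + g) by apply: wip_ge0 => x _ /=.
  rewrite wip_linl ?wip_linr//; try exact: L2_lin.
  by rewrite [wip _ g f]wipC => h; apply: le_trans h _; rewrite le_eqVlt; apply/orP; left; apply/eqP; ring.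
rewrite -(@ler_pXn2r _ 2) ?nnegrE ?mulr_ge0 ?sqrtr_ge0//.
rewrite exprMn !normL2_wip real_normK ?num_real//.
have [f0|f0] := eqVneq (wip (cst 1) f f) 0.
  have fz : ae_eq mu Om f (0 : _ -> R) by exact: wip_eq0.
  rewrite (_ : wip _ f g = 0) ?expr0n ?mulr_ge0 ?wip_ge0//.
  rewrite (wip_ae w1 Lf L0 Lg Lg fz (ae_eq_refl _ _ _)).
  exact: wip0l.
have fp : 0 < wip (cst 1) f f by rewrite lt_def f0/=; exact: wip_ge0.
have := key (- (wip (cst 1) f g / wip (cst 1) f f)).
move: fp f0 => {key}; set A := wip _ f f; set B := wip _ f g; set C := wip _ g g => Ap A0.
rewrite (_ : _ + _ = C - B ^+ 2 / A); last by field.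
by rewrite subr_ge0 ler_pdivrMr// mulrC.
Qed.

End L2_theory.

(** * Weak derivatives on H10 *)

Section test_functions.
Context {R : realType} {V : normedModType R}.

(** The support does not grow: off the closed support, [f] vanishes in a neighbourhood, hence so
    does its derivative. *)
Lemma test_function_derive (U : set V) (f : V -> R) v :
  test_function U f -> test_function U ('D_v f).
Proof.
move=> [sf cf fU]; have sub : closure [set x | 'D_v f x != 0] `<=` closure [set x | f x != 0].
  apply: subset_trans (@closed_closure _ _); apply: closure_subset => x /= Dx B nB.
  apply: contrapT => nAB; move/eqP: Dx; apply.
  rewrite -[RHS](derive_cst (0 : R) x v); apply: near_eq_derive.
  apply: filterS nB => y By; apply: contrapT => /eqP fy.
  by apply: nAB; exists y.
split=> [s||]; last exact: subset_trans fU.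
  (* The last direction of the list is the one differentiated first. *)
  by have := sf (rcons s v); rewrite /iter_derive -cats1 foldr_cat.
apply: subclosed_compact cf sub; exact: closed_closure.
Qed.

Lemma test_function_bounded (U : set V) (f : V -> R) :
  test_function U f -> exists M, forall x, `|f x| <= M.
Proof.
move=> [/(_ [::]) [/= cf _] cs _].
have /compact_bounded[N [_ /(_ (N + 1))]] : compact (f @` closure [set x | f x != 0]).
  by apply: continuous_compact => //; exact: continuous_subspaceT.
(* The maximum with 0 serves the points where [f] vanishes, since [N] may be negative. *)
rewrite ltrDl ltr01 => /(_ isT) bf; exists (Num.max 0 (N + 1)) => x.
have [->|fx0] := eqVneq (f x) 0; first by rewrite normr0 le_max lexx.
rewrite le_max; apply/orP; right; apply: bf; exists x => //.
exact: subset_closure.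
Qed.

End test_functions.

Section sobolev_H10.
Context {R : realType} (d : nat) (Om : set 'rV[R]_d).
Hypotheses (oOm : open Om) (bOm : bounded_set Om).
Implicit Types f g r phi : 'rV[R]_d -> R.

Local Notation mu := (lebesgue_rV d).
Local Notation e_ i := (delta_mx ord0 i : 'rV[R]_d).

Let mOm : measurable Om. Proof. exact: open_measurable_rV. Qed.

Lemma wip1E f g : wip Om (cst 1) f g = integral_on Om (fun x => f x * g x).
Proof. by congr (integral_on _ _); apply/funext => x; rewrite /= mul1r. Qed.

(** A bounded function on a set of finite measure; the measure is finite because [Om] is bounded. *)
Lemma test_function_L2 phi : test_function Om phi -> L2 Om phi.
Proof.
move=> tphi; have [M phiM] := test_function_bounded tphi.
have [/(_ [::]) [/= cphi _] _ _] := tphi.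
have mphi : measurable_fun Om phi.
  by apply: measurable_funS (continuous_measurable_rV cphi).
split=> //; apply: (@le_lt_trans _ _ (\int[mu]_(x in Om) (M ^+ 2)%:E)%E).
  apply: ge0_le_integral => //.
  - by move=> x _; rewrite lee_fin sqr_ge0.
  - by apply/measurable_EFinP; exact: measurable_funX.
  - move=> x _; rewrite lee_fin -(real_normK (num_real (phi x))).
    by rewrite ler_pXn2r ?nnegrE//; exact: le_trans (phiM x).
rewrite integral_cst// lte_mul_pinfty ?lee_fin ?sqr_ge0//.
exact: bounded_lebesgue_rV_lty.
Qed.

(** Membership in [H1] excludes the junk value of [partial]. *)
Lemma weak_partial_partial i f : H1 Om f -> weak_partial Om i f (partial Om i f).
Proof. by move=> [_ /(_ i)]; exact: xgetPex. Qed.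

Lemma L2_partial i f : H1 Om f -> L2 Om (partial Om i f).
Proof. by move=> /(weak_partial_partial i)[]. Qed.

Lemma H10_L2 f : H10 Om f -> L2 Om f.
Proof. by move=> [[]]. Qed.

Lemma H10_L2_partial i f : H10 Om f -> L2 Om (partial Om i f).
Proof. by move=> [/(L2_partial i)]. Qed.

(** The zero distribution, for an L2 function: the form in which a defect of linearity of [partial]
    first appears. *)
Definition weakly_null r :=
  forall phi, test_function Om phi -> wip Om (cst 1) r phi = 0.

(* The partial derivatives of f are L2-limits of derivatives of test functions,
   which are test functions themselves. *)
Lemma weakly_null_partial i r f : L2 Om r -> weakly_null r -> H10 Om f ->
  wip Om (cst 1) r (partial Om i f) = 0.
Proof.
move=> Lr r0 [Hf [phi [tphi _ /(_ i) phif]]].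
have w1 := @weight_cst R d Om 1.
set c := wip _ _ _ _; apply/eqP; rewrite -normr_le0.
(* Since [r] is orthogonal to the derivative of [phi k], [c] is up to sign the pairing of [r] with
   the approximation error, for every [k]; Cauchy-Schwarz bounds it by this null sequence. *)
have : (normL2 Om r * normL2 Om ('D_(e_ i) (phi k) \- partial Om i f)) @[k --> \oo] --> normL2 Om r * 0.
  by apply: cvgMr.
rewrite mulr0 => /cvgr_to_ge; apply; apply: nearW => k.
have tD := test_function_derive (e_ i) (tphi k).
have -> : `|c| = `|wip Om (cst 1) r ('D_(e_ i) (phi k) \- partial Om i f)|.
  have -> : 'D_(e_ i) (phi k) \- partial Om i f = (-1) *: partial Om i f + 'D_(e_ i) (phi k).
    by rewrite scaleN1r addrC.
  rewrite wip_linr//; [|exact: L2_partial|exact: test_function_L2].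
  by rewrite (r0 _ tD) addr0 mulN1r normrN.
apply: wip_cauchy_schwarz => //.
have -> : 'D_(e_ i) (phi k) \- partial Om i f = (-1) *: partial Om i f + 'D_(e_ i) (phi k).
  by rewrite scaleN1r addrC.
apply: L2_lin => //; [exact: L2_partial|exact: test_function_L2].
Qed.

Lemma wip_partial i f phi : H1 Om f -> test_function Om phi ->
  wip Om (cst 1) (partial Om i f) phi = - wip Om (cst 1) f ('D_(e_ i) phi).
Proof.
move=> /(weak_partial_partial i)[_ h] tphi.
by rewrite !wip1E h// opprK.
Qed.

(** The defect [r] is weakly null by integration by parts, and it combines derivatives of [H10]
    functions, so it is orthogonal to itself. That the combination lies in [H10] is later supplied
    by the finite element spaces. *)
Lemma partial_lin i a f g : H10 Om f -> H10 Om g -> H10 Om (a *: f + g) ->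
  ae_eq mu Om (partial Om i (a *: f + g)) (a *: partial Om i f + partial Om i g).
Proof.
move=> Hf Hg Hh; have w1 := @weight_cst R d Om 1.
set h := a *: f + g in Hh *; set Df := partial _ _ f; set Dg := partial _ _ g.
set Dh := partial _ _ h.
have Lf : L2 Om Df by exact: H10_L2_partial.
have Lg : L2 Om Dg by exact: H10_L2_partial.
have Lh : L2 Om Dh by exact: H10_L2_partial.
have Ls : L2 Om (a *: Df + Dg) by exact: L2_lin.
pose r := (-1) *: (a *: Df + Dg) + Dh.
have Lr : L2 Om r by exact: L2_lin.
have rnull : weakly_null r.
  move=> phi tphi; have Lphi := test_function_L2 tphi.
  have LD := test_function_L2 (test_function_derive (e_ i) tphi).
  rewrite /r !wip_linl// !wip_partial//; try by [case: Hf|case: Hg|case: Hh].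
  rewrite {1}/h wip_linl//; try exact: H10_L2.
  by ring.
have rr : wip Om (cst 1) r r = 0.
  rewrite {2}/r !wip_linr// !weakly_null_partial//; try by [case: Hf|case: Hg|case: Hh].
  by rewrite !mulr0 !addr0 mulr0.
have := wip_eq0 mOm Lr rr; apply: filterS => x /= h0 /h0.
rewrite (_ : r x = Dh x - (a *: Df + Dg) x); first by move/subr0_eq.
by rewrite /r scaleN1r addrC.
Qed.

(** Integration by parts makes the derivative weakly null; being the derivative of an [H10]
    function, it is then orthogonal to itself. *)
Lemma partial_null i f : H10 Om f -> ae_eq mu Om f (cst 0) ->
  ae_eq mu Om (partial Om i f) (cst 0).
Proof.
move=> Hf f0; have w1 := @weight_cst R d Om 1.
have Lf := H10_L2 Hf; have LD := H10_L2_partial i Hf.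
apply: wip_eq0 => //; apply: weakly_null_partial => // phi tphi.
have LDphi := test_function_L2 (test_function_derive (e_ i) tphi).
rewrite wip_partial; [|by case: Hf|by []].
have L0 : L2 Om 0 by exact: L2_0.
rewrite (wip_ae mOm w1 Lf L0 LDphi LDphi f0 (ae_eq_refl _ _ _)).
by rewrite wip0l// oppr0.
Qed.

End sobolev_H10.

(** * Bilinear forms on finitely generated spaces *)

Section solvability.
Context {K : fieldType}.

Definition subspace (W : lmodType K) (S : set W) :=
  S 0 /\ forall a x y, S x -> S y -> S (a *: x + y).

(** Finite dimension modulo the null vectors [N]; carrying [N] along replaces the passage to a
    quotient space. *)
Definition generated (W : lmodType K) (S N : set W) :=
  exists (n : nat) (b : 'I_n -> W), (forall i, S (b i)) /\
    forall x, S x -> exists c : 'I_n -> K, N (x - \sum_i c i *: b i).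

(** The linearity clauses presuppose that the combination belongs to the set, so they make sense on
    sets not known to be closed under combinations. Null vectors are killed in the second argument
    only. *)
Definition bilinear_on (V W : lmodType K) (S : set V) (S' N' : set W)
    (B : V -> W -> K) :=
  [/\ forall a x y z, S x -> S y -> S (a *: x + y) -> S' z ->
        B (a *: x + y) z = a * B x z + B y z,
      forall a x y z, S z -> S' x -> S' y -> S' (a *: x + y) ->
        B z (a *: x + y) = a * B z x + B z y &
      forall x y, S x -> S' y -> N' y -> B x y = 0].

Lemma subspace_sum (W : lmodType K) (S : set W) n (b : 'I_n -> W) c :
  subspace S -> (forall i, S (b i)) -> S (\sum_i c i *: b i).
Proof.
move=> [S0 Sl] Sb; elim/big_rec: _ => // i x _ Sx; exact: Sl.
Qed.

Lemma linear_on_sum (W : lmodType K) (S : set W) (L : W -> K) n (b : 'I_n -> W) c :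
  subspace S -> (forall a x y, S x -> S y -> L (a *: x + y) = a * L x + L y) ->
  (forall i, S (b i)) -> L (\sum_i c i *: b i) = \sum_i c i * L (b i).
Proof.
move=> [S0 Sl] Ll Sb.
have L0 : L 0 = 0.
  by have /eqP := Ll 1 0 0 S0 S0; rewrite scale1r addr0 mul1r -subr_eq0 opprD addNKr oppr_eq0 => /eqP.
suff : S (\sum_i c i *: b i) /\ L (\sum_i c i *: b i) = \sum_i c i * L (b i) by case.
elim/big_rec2: _ => // i x y _ [Sx Lx]; split; first exact: Sl.
by rewrite Ll// Lx.
Qed.

(* A form that is nondegenerate on the left modulo null vectors has Gram matrix
   M with ker M contained in ker M^T; the two kernels have the same rank, so
   they are equal, and a functional vanishing on null vectors is orthogonal to
   ker M^T, hence in the range of M. *)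
Lemma bilinear_on_solvable (W : lmodType K) (S N : set W) (B : W -> W -> K) (L : W -> K) :
  subspace S -> generated S N -> bilinear_on S S N B ->
  (forall a x y, S x -> S y -> L (a *: x + y) = a * L x + L y) ->
  (forall x, S x -> N x -> L x = 0) ->
  (forall x, S x -> (forall y, S y -> B x y = 0) -> N x) ->
  exists2 x, S x & forall y, S y -> B x y = L y.
Proof.
move=> subS [n [b [Sb gen]]] [Bl Br B0] Ll L0 nondeg.
have [S0 Sl] := subS.
pose M := \matrix_(i, j) B (b i) (b j).
pose l := \row_j L (b j).
pose v (c : 'rV[K]_n) := \sum_i c ord0 i *: b i.
have Sv c : S (v c) by exact: subspace_sum.
have Bv c y : S y -> B (v c) y = \sum_i c ord0 i * B (b i) y.
  move=> Sy; apply: (linear_on_sum (L := B ^~ y) _ subS) => // a x x' Sx Sx'.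
  by apply: Bl => //; exact: Sl.
have Bv' c x : S x -> B x (v c) = \sum_i c ord0 i * B x (b i).
  move=> Sx; apply: (linear_on_sum (L := B x) _ subS) => // a y y' Sy Sy'.
  by apply: Br => //; exact: Sl.
have Lv c : L (v c) = \sum_i c ord0 i * L (b i) by exact: (linear_on_sum _ subS).
(* Functionals that kill null vectors are determined by their values on the generators, as every [x]
   differs from a combination of these by a null vector. *)
have ext (L1 L2 : W -> K) :
    (forall a x y, S x -> S y -> L1 (a *: x + y) = a * L1 x + L1 y) ->
    (forall a x y, S x -> S y -> L2 (a *: x + y) = a * L2 x + L2 y) ->
    (forall x, S x -> N x -> L1 x = 0) -> (forall x, S x -> N x -> L2 x = 0) ->
    (forall i, L1 (b i) = L2 (b i)) -> forall x, S x -> L1 x = L2 x.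
  move=> l1 l2 n1 n2 e x Sx; have [c Nc] := gen x Sx.
  have Ss : S (\sum_i c i *: b i) by exact: subspace_sum.
  have Sd : S (x - \sum_i c i *: b i) by rewrite addrC -scaleN1r; exact: Sl.
  have -> : x = 1 *: (x - \sum_i c i *: b i) + \sum_i c i *: b i by rewrite scale1r subrK.
  rewrite l1// l2// n1// n2//; congr (_ + _).
  rewrite (linear_on_sum c subS l1)// (linear_on_sum c subS l2)//.
  by apply: eq_bigr => i _; rewrite e.
have Br' x : S x -> forall a y y', S y -> S y' -> B x (a *: y + y') = a * B x y + B x y'.
  by move=> Sx a y y' Sy Sy'; apply: Br => //; exact: Sl.
have mulE c j : (c *m M) ord0 j = B (v c) (b j).
  by rewrite Bv// mxE; apply: eq_bigr => i _; rewrite mxE.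
have ker (c : 'rV[K]_n) : c *m M = 0 -> N (v c).
  move=> cM; apply: nondeg => //; apply: (ext (B (v c)) (fun=> 0)) => //.
  - exact: Br'.
  - by move=> *; rewrite mulr0 addr0.
  - by move=> x Sx; exact: B0.
  - by move=> j; rewrite -mulE cM mxE.
have kerT (c : 'rV[K]_n) : c *m M = 0 -> c *m M^T = 0.
  move=> /ker Nc; apply/rowP => i; rewrite [RHS]mxE -(B0 (b i) (v c))// Bv'// mxE.
  by apply: eq_bigr => j _; rewrite !mxE.
have kerE : (kermx M^T <= kermx M)%MS.
  have le : (kermx M <= kermx M^T)%MS.
    apply/row_subP => i; apply/sub_kermxP/kerT.
    by rewrite -row_mul mulmx_ker row0.
  by rewrite -(mxrank_leqif_sup le) !mxrank_ker mxrank_tr.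
have /submxP[c lc] : (l <= M)%MS.
  rewrite submxE; apply/eqP/rowP => j; rewrite [RHS]mxE.
  (* Transposing [M *m cokermx M = 0] puts [w] in the kernel of [M^T], hence in that of [M]; so
     [v w] is null and [L] vanishes on it, which is the orthogonality of [l] to this column of the
     cokernel. *)
  pose w := row j (cokermx M)^T.
  have wM : w *m M = 0.
    apply/sub_kermxP/(submx_trans _ kerE)/sub_kermxP.
    by rewrite -row_mul -trmx_mul mulmx_coker trmx0 row0.
  have Nw := ker _ wM; rewrite -(L0 (v w))// Lv mxE; apply: eq_bigr => i _.
  by rewrite !mxE mulrC.
exists (v c) => //; apply: ext => //; first exact: Br'.
  by move=> x Sx; exact: B0.
by move=> j; rewrite -mulE -lc mxE.
Qed.

Lemma subspace_prod (V W : lmodType K) (S : set V) (S' : set W) :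
  subspace S -> subspace S' -> subspace (S `*` S').
Proof.
move=> [S0 Sl] [S0' Sl']; split=> // a [x y] [x' y'] /= [Sx Sy] [Sx' Sy'].
by split; [exact: Sl|exact: Sl'].
Qed.

(** The generators of both factors, padded with 0, generate the product. *)
Lemma generated_prod (V W : lmodType K) (S N : set V) (S' N' : set W) :
  subspace S -> subspace S' ->
  generated S N -> generated S' N' -> generated (S `*` S') (N `*` N').
Proof.
move=> [S0 _] [S0' _] [n [b [Sb gb]]] [m [b' [Sb' gb']]].
exists (n + m)%N, (fun k => match fintype.split k with inl i => (b i, 0) | inr j => (0, b' j) end).
split=> [k|[x y] [/= /gb[c Nc] /gb'[c' Nc']]]; first by case: (fintype.split k) => j; split=> //=.
exists (fun k => match fintype.split k with inl i => c i | inr j => c' j end).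
set s := \sum_(_ < _) _.
have -> : s = (\sum_i c i *: b i, \sum_i c' i *: b' i).
  rewrite /s big_split_ord/= (eq_bigr (fun i => (c i *: b i, 0))); last first.
    by move=> i _; rewrite (unsplitK (inl i)); congr (_, _); exact: scaler0.
  rewrite [X in _ + X](eq_bigr (fun i => (0, c' i *: b' i))); last first.
    by move=> i _; rewrite (unsplitK (inr i)); congr (_, _); exact: scaler0.
  apply: injective_projections => /=.
    rewrite [fst (\sum_i _)](raddf_sum (@fst V W)) [X in _ + X](raddf_sum (@fst V W))/=.
    by rewrite [X in _ + X]big1 ?addr0.
  rewrite [snd (\sum_i _)](raddf_sum (@snd V W)) [X in _ + X](raddf_sum (@snd V W))/=.
  by rewrite [X in X + _]big1 ?add0r.
by split.
Qed.

End solvability.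

(** * Bilinear forms of L2 operators *)

Section bilinear_on_operations.
Context {K : fieldType} {V W : lmodType K} (S : set V) (S' N' : set W).
Implicit Types B : V -> W -> K.

Lemma bilinear_on_lin c1 c2 B1 B2 :
  bilinear_on S S' N' B1 -> bilinear_on S S' N' B2 ->
  bilinear_on S S' N' (fun x y => c1 * B1 x y + c2 * B2 x y).
Proof.
move=> [l1 r1 n1] [l2 r2 n2]; split=> [a x y z *|a x y z *|x y *].
- by rewrite l1// l2//; ring.
- by rewrite r1// r2//; ring.
- by rewrite n1// n2// !mulr0 addr0.
Qed.

Lemma bilinear_on_sum (I : finType) (B : I -> V -> W -> K) :
  (forall i, bilinear_on S S' N' (B i)) ->
  bilinear_on S S' N' (fun x y => \sum_i B i x y).
Proof.
move=> bB; split=> [a x y z *|a x y z *|x y *].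
- rewrite mulr_sumr -big_split/=; apply: eq_bigr => i _.
  by have [l _ _] := bB i; rewrite l.
- rewrite mulr_sumr -big_split/=; apply: eq_bigr => i _.
  by have [_ r _] := bB i; rewrite r.
- by rewrite big1// => i _; have [_ _ n] := bB i; rewrite n.
Qed.

Lemma bilinear_on_eq B B' :
  (forall x y, S x -> S' y -> B x y = B' x y) ->
  bilinear_on S S' N' B' -> bilinear_on S S' N' B.
Proof.
move=> BB [l r n]; split=> [a x y z *|a x y z *|x y *].
- by rewrite !BB// l.
- by rewrite !BB// r.
- by rewrite BB// n.
Qed.

Lemma bilinear_onS (S1 : set V) (S2 : set W) B :
  S1 `<=` S -> S2 `<=` S' -> bilinear_on S S' N' B -> bilinear_on S1 S2 N' B.
Proof.
move=> sS sS' [l r n]; split=> [a x y z *|a x y z *|x y *].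
- by apply: l; [exact: sS|exact: sS|exact: sS|exact: sS'].
- by apply: r; [exact: sS|exact: sS'|exact: sS'|exact: sS'].
- by apply: n => //; [exact: sS|exact: sS'].
Qed.

End bilinear_on_operations.

(** * Bounded coefficients and the truncation *)

Section weights.
Context {R : realType} (d : nat) (Om : set 'rV[R]_d).
Hypothesis mOm : measurable Om.
Implicit Types k t : 'rV[R]_d -> R.

Lemma weight_mul k k' : weight Om k -> weight Om k' -> weight Om (fun x => k x * k' x).
Proof.
move=> [mk [M kM]] [mk' [M' kM']]; split; first exact: measurable_funM.
exists (M * M') => x Ox; rewrite normrM.
by apply: ler_pM => //; [exact: kM|exact: kM'].
Qed.

Lemma weight_affine (a b : R) t : weight Om t -> weight Om (fun x => a + b * t x).
Proof.
move=> [mt [M tM]]; split.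
  by apply: measurable_funD => //; exact: measurable_funM.
exists (`|a| + `|b| * M) => x Ox; apply: (le_trans (ler_normD _ _)).
by rewrite lerD2l normrM ler_wpM2l// tM.
Qed.

Lemma weight_inv (c : R) k : 0 < c -> (forall x, Om x -> c <= k x) -> weight Om k ->
  weight Om (fun x => (k x)^-1).
Proof.
move=> c0 ck [mk _]; split.
  (* The inverse is discontinuous at 0; on [Om] it agrees with the inverse of [Num.max c y], which
     is continuous everywhere. *)
  apply: (@eq_measurable_fun _ _ _ _ _ ((fun y => (Num.max c y)^-1) \o k)).
    by move=> x; rewrite inE => Ox /=; rewrite max_r// ck.
  apply: measurableT_comp => //; apply: continuous_measurable_fun => y.
  have cm : (Num.max c z @[z --> y] --> Num.max c y)%R.
    by apply: continuous_max; [exact: cvg_cst|exact: cvg_id].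
  by apply: cvgV => //; rewrite gt_eqF// lt_max c0.
exists c^-1 => x Ox; have cx := ck x Ox.
have k0 : 0 < k x by exact: lt_le_trans cx.
by rewrite ger0_norm ?lef_pV2 ?posrE// invr_ge0 ltW.
Qed.

(** Written with minimum and maximum, the truncation is visibly measurable and bounded. *)
Lemma truncation_clamp (delta y : R) : 0 <= delta ->
  truncation delta y = Num.max (- delta) (Num.min y delta).
Proof.
move=> d0; rewrite /truncation ler_norml; case: ifPn => [/andP[y1 y2]|].
  by rewrite min_l// max_r.
rewrite negb_and -!ltNge => /orP[yd|dy].
  have y0 : y < 0 by apply: lt_le_trans yd _; rewrite oppr_le0.
  rewrite ltr0_sg// mulrN1 max_l// min_l ?ltW//.
  by apply: lt_le_trans y0 _.
by rewrite gtr0_sg ?(le_lt_trans d0)// mulr1 min_r ?ltW// max_r// ge0_cp.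
Qed.

Lemma truncation_norm_le (delta y : R) : 0 <= delta -> `|truncation delta y| <= delta.
Proof.
move=> d0; rewrite truncation_clamp// ler_norml le_max lexx/= ge_max.
by rewrite ge_min lexx orbT andbT ge0_cp.
Qed.

Lemma weight_truncation (delta : R) f : 0 <= delta -> measurable_fun Om f ->
  weight Om (fun x => truncation delta (f x)).
Proof.
move=> d0 mf; split; last by exists delta => x _; exact: truncation_norm_le.
rewrite (_ : (fun _ => _) = fun x => Num.max (- delta) (Num.min (f x) delta)).
  apply: measurable_maxr => //; exact: measurable_minr.
by apply/funext => x; exact: truncation_clamp.
Qed.

End weights.

(** * Operators into L2 that are linear almost everywhere *)

Section L2_operators.
Context {R : realType} (d : nat) (Om : set 'rV[R]_d).
Hypothesis mOm : measurable Om.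

Local Notation scalar := ('rV[R]_d -> R).
Local Notation field := ('rV[R]_d -> 'rV[R]_d).
Local Notation mu := (lebesgue_rV d).

Definition ae_null (W : lmodType R) : set ('rV[R]_d -> W) :=
  [set f : 'rV[R]_d -> W | ae_eq mu Om f 0].

(** Linearity holds almost everywhere only, because the values of [partial] are chosen
    representatives. *)
Definition L2_operator (E : lmodType R) (S N : set E) (A : E -> scalar) :=
  [/\ forall x, S x -> L2 Om (A x),
      forall a x y, S x -> S y -> S (a *: x + y) ->
        ae_eq mu Om (A (a *: x + y)) (a *: A x + A y) &
      forall x, S x -> N x -> ae_null (A x)].

Lemma L2_operator_lin (E : lmodType R) (S N : set E) A A' c :
  L2_operator S N A -> L2_operator S N A' ->
  L2_operator S N (fun x => c *: A x + A' x).
Proof.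
move=> [LA lA nA] [LA' lA' nA']; split=> [x Sx|a x y Sx Sy Sxy|x Sx Nx].
- by apply: L2_lin => //; [exact: LA|exact: LA'].
- apply: filterS2 (lA a x y Sx Sy Sxy) (lA' a x y Sx Sy Sxy) => z h h' Oz.
  have := h Oz; have := h' Oz; move: (A _) (A' _) => f f'.
  rewrite -[(c *: f + f') z]/(c * f z + f' z) => -> ->.
  rewrite -[(a *: A x + A y) z]/(a * A x z + A y z).
  rewrite -[(a *: A' x + A' y) z]/(a * A' x z + A' y z).
  rewrite -[RHS]/(a * (c * A x z + A' x z) + (c * A y z + A' y z)).
  by ring.
- apply: filterS2 (nA x Sx Nx) (nA' x Sx Nx) => z h h' Oz.
  rewrite -[LHS]/(c * A x z + A' x z) h// h'//.
  by rewrite -[0 z]/(0 : R) mulr0 addr0.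
Qed.

Lemma L2_operator_0 (E : lmodType R) (S N : set E) :
  L2_operator S N (fun=> 0).
Proof.
split=> [x _|a x y _ _ _|x _ _]; first exact: L2_0.
  by apply/aeW => z _; rewrite scaler0 addr0.
exact/aeW.
Qed.

Lemma L2_operator_sum (E : lmodType R) (S N : set E) (I : finType) (A : I -> E -> scalar) :
  (forall i, L2_operator S N (A i)) -> L2_operator S N (fun x => \sum_i A i x).
Proof.
move=> hA; rewrite (_ : (fun x => _) =
  fun x => foldr (fun i f => 1 *: A i x + f) 0 (index_enum I)); last first.
  apply/funext => x; rewrite unlock /=.
  by elim: (index_enum I) => //= i s ->; rewrite scale1r.
elim: (index_enum I) => [|i s IH] /=; first exact: L2_operator_0.
exact: L2_operator_lin.
Qed.

(** Integration turns almost everywhere linearity into exact linearity; all forms of the discrete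
    system are built from such products. *)
Lemma bilinear_on_wip (E E' : lmodType R) (S N : set E) (S' N' : set E') k A A' :
  weight Om k -> L2_operator S N A -> L2_operator S' N' A' ->
  bilinear_on S S' N' (fun x y => wip Om k (A x) (A' y)).
Proof.
move=> wk [LA lA nA] [LA' lA' nA'].
split=> [a x y z Sx Sy Sxy Sz|a x y z Sz Sx Sy Sxy|x y Sx Sy Ny].
- rewrite -wip_linl//; [|exact: LA|exact: LA|exact: LA'].
  apply: (wip_ae mOm wk) => //; [exact: LA|by apply: L2_lin => //; exact: LA
    |exact: LA'|exact: LA'|exact: lA|exact: ae_eq_refl].
- rewrite -wip_linr//; [|exact: LA'|exact: LA'|exact: LA].
  apply: (wip_ae mOm wk) => //; [exact: LA|exact: LA|exact: LA'
    |by apply: L2_lin => //; exact: LA'|exact: ae_eq_refl|exact: lA'].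
- rewrite wipC -(@wip0l _ _ _ mOm k (A x))//; last exact: LA.
  apply: (wip_ae mOm wk) => //; [exact: LA'|exact: L2_0|exact: LA|exact: LA|exact: nA'
    |exact: ae_eq_refl].
Qed.

Lemma integral_on_wip_sum (I : finType) k (f g : I -> scalar) :
  weight Om k -> (forall i, L2 Om (f i)) -> (forall i, L2 Om (g i)) ->
  integral_on Om (fun x => k x * \sum_i f i x * g i x) = \sum_i wip Om k (f i) (g i).
Proof.
move=> wk Lf Lg.
(* The induction carries integrability along, which additivity of the integral requires. *)
suff [_] : mu.-integrable Om (EFin \o (fun x => k x * \sum_i f i x * g i x)) /\
  integral_on Om (fun x => k x * \sum_i f i x * g i x) = \sum_i wip Om k (f i) (g i) by [].
elim: (index_enum I) => [|i s [IHi IH]].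
  rewrite (_ : (fun x => _) = cst 0); last first.
    by apply/funext => x; rewrite big_nil mulr0.
  rewrite big_nil; split; first exact: integrable0.
  by rewrite /integral_on /Rintegral integral0.
have Ii := L2_mul_integrable mOm wk (Lf i) (Lg i).
rewrite (_ : (fun x => _) = fun x => k x * (f i x * g i x) +
    k x * \sum_(i <- s) f i x * g i x); last first.
  by apply/funext => x; rewrite big_cons mulrDr.
rewrite big_cons -IH; split; last exact: RintegralD.
rewrite [_ \o _](_ : _ = (EFin \o (fun x => k x * (f i x * g i x))%R) \+
  (EFin \o (fun x => k x * \sum_(i <- s) f i x * g i x)%R))%E//.
exact: integrableD.
Qed.

End L2_operators.

(** * The coupled step *)

Section coupled_step.
Context {R : realFieldType} {E F : lmodType R}.
Variables (H U X N : set E) (Q NQ : set F).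
Variables (m k g : E -> E -> R) (b : F -> E -> R).
Variables (alpha rho nu dt : R) (uold vold : E).
Hypotheses (alpha0 : 0 < alpha) (rho0 : 0 < rho) (nu0 : 0 < nu) (dt0 : 0 < dt).
Hypotheses (subH : subspace H) (subU : subspace U) (subX : subspace X)
  (subQ : subspace Q) (UH : U `<=` H) (XH : X `<=` H).
Hypotheses (genU : generated U N) (genX : generated X N) (genQ : generated Q NQ).
Hypotheses (Uuold : U uold) (Xvold : X vold).
Hypotheses (bm : bilinear_on H H N m)
  (m_sym : forall x y, H x -> H y -> m x y = m y x)
  (m_ge0 : forall x, H x -> 0 <= m x x)
  (m_def : forall x, H x -> m x x = 0 -> N x).
Hypotheses (bk : bilinear_on U U N k) (k_ge0 : forall x, U x -> 0 <= k x x).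
Hypotheses (bg : bilinear_on X X N g) (g_ge0 : forall x, X x -> 0 <= g x x)
  (g_sym : forall x y, X x -> X y -> g x y = g y x).
Hypotheses (bb : bilinear_on Q X N b)
  (b_null : forall q w, Q q -> X w -> NQ q -> b q w = 0)
  (b_inj : forall q, Q q -> (forall w, X w -> b q w = 0) -> NQ q).

(** The discrete system in abstract form: [m] is the mass, [k] the elastic stiffness, [g] the
    product of gradients and [b] the pairing of pressure and divergence. *)
Definition coupled_system (u v : E) (p : F) :=
  [/\ U u, X v /\ forall q, Q q -> b q v = 0, Q p,
    forall z, U z -> alpha / dt * m (u - uold) z + k u z = alpha * m v z &
    forall w, X w -> rho / dt * m (v - vold) w - b p w + nu * g v w +
      alpha * m v w = alpha / dt * m (u - uold) w].

Let S : set (E * (F * E)) := U `*` (Q `*` X).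
Let Nul : set (E * (F * E)) := N `*` (NQ `*` N).

Let Bu (x : E * (F * E)) z :=
  alpha / dt * m x.1 z + k x.1 z - alpha * m x.2.2 z.
Let Bv (x : E * (F * E)) w := rho / dt * m x.2.2 w - b x.2.1 w +
  nu * g x.2.2 w + alpha * m x.2.2 w - alpha / dt * m x.1 w.
(** The last summand is the divergence constraint tested with the pressure component. It lets [v]
    range over all of [X], so that unknowns and tests lie in the same space [S]. *)
Let B (x y : E * (F * E)) := Bu x y.1 + Bv x y.2.2 + b y.2.1 x.2.2.
Let L (y : E * (F * E)) := alpha / dt * m uold y.1 +
  (rho / dt * m vold y.2.2 - alpha / dt * m uold y.2.2).

Let subS : subspace S.
Proof. by apply: subspace_prod => //; exact: subspace_prod. Qed.

Let bilB : bilinear_on S S Nul B.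
Proof.
have [ml mr mn] := bm; have [kl kr kn] := bk.
have [gl gr gn] := bg; have [bl br bn] := bb.
split.
- move=> a [u [p v]] [u' [p' v']] [z [q w]] [/= Uu [Qp Xv]] [/= Uu' [Qp' Xv']].
  move=> [/= Us [Qs Xs]] [/= Uz [Qq Xw]]; rewrite /B /Bu /Bv /=.
  have [Hu Hv] := (UH Uu, XH Xv); have [Hu' Hv'] := (UH Uu', XH Xv').
  have [Hz Hw] := (UH Uz, XH Xw); have [HU HX] := (UH Us, XH Xs).
  by rewrite !ml// kl// gl// bl// br//; ring.
- move=> a [u [p v]] [u' [p' v']] [z [q w]] [/= Uz [Qq Xw]].
  move=> [/= Uu [Qp Xv]] [/= Uu' [Qp' Xv']] [/= Us [Qs Xs]]; rewrite /B /Bu /Bv /=.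
  have [Hu Hv] := (UH Uu, XH Xv); have [Hu' Hv'] := (UH Uu', XH Xv').
  have [Hz Hw] := (UH Uz, XH Xw); have [HU HX] := (UH Us, XH Xs).
  by rewrite !mr// kr// gr// bl// br//; ring.
- move=> [u [p v]] [z [q w]] [/= Uu [Qp Xv]] [/= Uz [Qq Xw]] [/= Nz [Nq Nw]].
  have [Hu Hv] := (UH Uu, XH Xv); have [Hz Hw] := (UH Uz, XH Xw).
  by rewrite /B /Bu /Bv /= !mn// kn// gn// bn// b_null//; ring.
Qed.

Let linL a x y : S x -> S y -> L (a *: x + y) = a * L x + L y.
Proof.
have [_ mr _] := bm; case: subS => _ Sl Sx Sy; have := Sl a _ _ Sx Sy.
case: x y Sx Sy => [u [p v]] [u' [p' v']] [/= Uu [Qp Xv]] [/= Uu' [Qp' Xv']].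
move=> [/= Us [Qs Xs]]; rewrite /L /=.
have [Hu Hv] := (UH Uu, XH Xv); have [Hu' Hv'] := (UH Uu', XH Xv').
have [Ho Ho'] := (UH Uuold, XH Xvold); have [HU HX] := (UH Us, XH Xs).
by rewrite !mr//; ring.
Qed.

Let nulL x : S x -> Nul x -> L x = 0.
Proof.
have [_ _ mn] := bm; case: x => [u [p v]] [/= Uu [Qp Xv]] [/= Nu [Np Nv]].
by rewrite /L /= !mn//; [ring|exact: UH|exact: XH|exact: XH|exact: XH|exact: UH|exact: UH].
Qed.

Let form0 (V W : lmodType R) (S1 : set V) (S2 N2 : set W) f :
  subspace S1 -> subspace S2 -> bilinear_on S1 S2 N2 f ->
  (forall y, S2 y -> f 0 y = 0) /\ (forall x, S1 x -> f x 0 = 0).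
Proof.
move=> [S10 _] [S20 _] [fl fr _]; split=> [y Sy|x Sx].
  have := fl 1 0 0 y S10 S10; rewrite scale1r addr0 mul1r => /(_ S10 Sy).
  by rewrite -{1}[f 0 y]addr0 => /addrI.
have := fr 1 0 0 x Sx S20; rewrite scale1r addr0 mul1r => /(_ S20 S20).
by rewrite -{1}[f x 0]addr0 => /addrI.
Qed.

(** Tests with one nonzero component recover the separate equations from the single form [B]. *)
Let split_tests u p v z q w : S (u, (p, v)) -> S (z, (q, w)) ->
  [/\ B (u, (p, v)) (z, (0, 0)) = Bu (u, (p, v)) z,
      B (u, (p, v)) (0, (0, w)) = Bv (u, (p, v)) w &
      B (u, (p, v)) (0, (q, 0)) = b q v].
Proof.
move=> [/= Uu [Qp Xv]] [/= Uz [Qq Xw]].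
have [m0l m0] := form0 subH subH bm; have [k0l k0] := form0 subU subU bk.
have [g0l g0] := form0 subX subX bg; have [b0l b0] := form0 subQ subX bb.
have [Hu Hv] := (UH Uu, XH Xv).
by rewrite /B /Bu /Bv /= !m0// k0// g0// b0// b0l//; split; ring.
Qed.

(* Testing with (u / dt, p, v), the coupling terms are absorbed by completing
   the square: alpha m(u / dt - v, u / dt - v) >= 0. *)
Let nondegenerate x : S x -> (forall y, S y -> B x y = 0) -> Nul x.
Proof.
case: x => [u [p v]] Sx Bx0; have [/= Uu [Qp Xv]] := Sx.
have [ml mr mn] := bm; have [kl kr kn] := bk; have [U0 Ul] := subU.
have [X0 Xl] := subX; have [Q0 Ql] := subQ; have [H0 Hl] := subH.
have [m0l m0] := form0 subH subH bm; have [k0l k0] := form0 subU subU bk.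
have [Hu Hv] := (UH Uu, XH Xv).
have Sxx := split_tests Sx Sx.
have Eu : Bu (u, (p, v)) u = 0 by case: Sxx => <- _ _; exact: Bx0.
have Ev : Bv (u, (p, v)) v = 0 by case: Sxx => _ <- _; exact: Bx0.
have Ep : b p v = 0 by case: Sxx => _ _ <-; exact: Bx0.
have sq : 0 <= dt^-1 ^+ 2 * m u u - 2 * dt^-1 * m u v + m v v.
  have Hs : H ((- dt^-1) *: u + v) by exact: Hl.
  have := m_ge0 Hs; rewrite ml// !mr// (m_sym Hv Hu) => h.
  by apply: le_trans h _; rewrite le_eqVlt; apply/orP; left; apply/eqP; ring.
have v0 : m v v = 0.
  apply/eqP; rewrite eq_le m_ge0// andbT.
  have kk := k_ge0 Uu; have gg := g_ge0 Xv; have vv := m_ge0 Hv.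
  have dti : 0 < dt^-1 by rewrite invr_gt0.
  move: Eu Ev; rewrite /Bu /Bv /= Ep (m_sym Hv Hu) => Eu Ev.
  (* The first equation divided by [dt], plus the second, minus [alpha] times the square [sq]: all
     terms with [alpha] cancel. *)
  have : dt^-1 * k u u + nu * g v v + rho / dt * m v v <= 0.
    rewrite (_ : _ + _ = dt^-1 * (alpha / dt * m u u + k u u - alpha * m u v) +
      (rho / dt * m v v - 0 + nu * g v v + alpha * m v v - alpha / dt * m u v) -
      alpha * (dt^-1 ^+ 2 * m u u - 2 * dt^-1 * m u v + m v v)); last by ring.
    by rewrite Eu Ev mulr0 !add0r oppr_le0 mulr_ge0// ltW.
  have h1 : 0 <= dt^-1 * k u u by rewrite mulr_ge0// ltW.
  have h2 : 0 <= nu * g v v by rewrite mulr_ge0// ltW.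
  move=> h3; have h4 : rho / dt * m v v <= 0.
    by apply: le_trans h3; rewrite lerDr addr_ge0.
  by rewrite pmulr_rle0 in h4; rewrite // divr_gt0.
have Nv : N v by exact: m_def.
(* As [v] is null, the coupling drops out of the first equation, which leaves two nonnegative terms
   of sum 0. *)
have u0 : m u u = 0.
  apply/eqP; rewrite eq_le m_ge0// andbT.
  have kk := k_ge0 Uu; move: Eu; rewrite /Bu /= (m_sym Hv Hu) (mn _ _ Hu Hv Nv) mulr0 subr0 => Eu.
  have h4 : alpha / dt * m u u <= 0 by rewrite -Eu lerDl.
  by rewrite pmulr_rle0 in h4; rewrite // divr_gt0.
have Nu : N u by exact: m_def.
split=> //=; split=> //=; apply: b_inj => // w Xw.
have Hw := XH Xw.
have Sw : S (u, (p, w)) by [].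
have Ew : Bv (u, (p, v)) w = 0.
  by case: (split_tests Sx Sw) => _ <- _; exact: Bx0.
have [_ _ gn] := bg.
(* Symmetry moves the null vectors [u] and [v] into the second argument, where the forms kill them;
   only the pressure term survives. *)
move: Ew; rewrite /Bv /= (m_sym Hv Hw) (m_sym Hu Hw) (g_sym Xv Xw) !mn// gn//.
by rewrite !mulr0 !(addr0, subr0) sub0r => /eqP; rewrite oppr_eq0 => /eqP.
Qed.

(** The test components vary independently, so the equations amount to one identity on [S]. *)
Let systemP u v p : coupled_system u v p <->
  S (u, (p, v)) /\ forall y, S y -> B (u, (p, v)) y = L y.
Proof.
have [ml mr mn] := bm; have [U0 Ul] := subU.
have [X0 Xl] := subX; have [Q0 Ql] := subQ; have [H0 Hl] := subH.
have [Ho Ho'] := (UH Uuold, XH Xvold).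
have [m0l m0] := form0 subH subH bm.
have mB x y z : H x -> H y -> H z -> m (x - y) z = m x z - m y z.
  by move=> Hx Hy Hz; rewrite addrC -scaleN1r ml//; [ring|exact: Hl].
split=> [[Uu [Xv bv] Qp Eu Ev]|[[/= Uu [Qp Xv]] E1]].
  split=> // -[z [q w]] [/= Uz [Qq Xw]].
  have [Hu Hv] := (UH Uu, XH Xv); have [Hz Hw] := (UH Uz, XH Xw).
  move: (Eu z Uz) (Ev w Xw); rewrite /B /Bu /Bv /L /= bv// !mB// => /eqP h1 /eqP h2.
  move: h1 h2; rewrite -subr_eq0 => /eqP h1; rewrite -subr_eq0 => /eqP h2.
  by apply/eqP; rewrite -subr_eq0 -[X in _ == X]addr0 -[X in _ == X + _]h1 -[X in _ == _ + X]h2; apply/eqP; ring.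
have Sx : S (u, (p, v)) by [].
have [Hu Hv] := (UH Uu, XH Xv).
split=> //.
- split=> // q Qq; have [_ _ <-] := split_tests Sx (conj U0 (conj Qq X0) : S (0, (q, 0))).
  by rewrite E1// /L /= !m0//; ring.
- move=> z Uz; have Hz := UH Uz.
  have [h _ _] := split_tests Sx (conj Uz (conj Q0 X0) : S (z, (0, 0))).
  move: h; rewrite E1// /L /Bu /= !m0// mB// => /eqP; rewrite -subr_eq0 => /eqP h.
  by apply/eqP; rewrite -subr_eq0 -oppr_eq0 -h; apply/eqP; ring.
- move=> w Xw; have Hw := XH Xw.
  have [_ h _] := split_tests Sx (conj U0 (conj Q0 Xw) : S (0, (0, w))).
  move: h; rewrite E1// /L /Bv /= !m0// !mB// => /eqP; rewrite -subr_eq0 => /eqP h.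
  by apply/eqP; rewrite -subr_eq0 -oppr_eq0 -h; apply/eqP; ring.
Qed.

(** Existence is [bilinear_on_solvable] applied to [B]; the difference of two solutions is
    annihilated by every test, hence null by [nondegenerate]. *)
Lemma coupled_system_unique_solution :
  exists u v p, coupled_system u v p /\ forall u' v' p', coupled_system u' v' p' ->
    [/\ N (u' - u), N (v' - v) & NQ (p' - p)].
Proof.
have gen : generated S Nul.
  by apply: generated_prod => //; [exact: subspace_prod|exact: generated_prod].
have [[u [p v]] Sx Bx] := bilinear_on_solvable subS gen bilB linL nulL nondegenerate.
exists u, v, p; split; first by apply/systemP.
move=> u' v' p' /systemP[Sx' Bx'].
have [_ Sl] := subS.
have Sd : S ((u', (p', v')) - (u, (p, v))) by rewrite addrC -scaleN1r; exact: Sl.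
suff : Nul ((u', (p', v')) - (u, (p, v))) by case=> /= ? [].
apply: nondegenerate => // y Sy; have [l _ _] := bilB.
rewrite addrC -scaleN1r l//; last by rewrite scaleN1r addrC.
by rewrite Bx// Bx'//; ring.
Qed.

End coupled_step.

(** * The forms of the discrete system *)

Section forms.
Context {R : realType} (d : nat) (Om : set 'rV[R]_d).
Hypotheses (oOm : open Om) (bOm : bounded_set Om).

Local Notation scalar := ('rV[R]_d -> R).
Local Notation field := ('rV[R]_d -> 'rV[R]_d).
Local Notation mu := (lebesgue_rV d).
Local Notation H := (vec (H10 Om)).
Local Notation null := (@ae_null R d Om _).
Implicit Types (u v w z : field) (k : scalar).

Let mOm : measurable Om. Proof. exact: open_measurable_rV. Qed.

Lemma finite_dim_subspaceW (W : lmodType R) (X S : set ('rV[R]_d -> W)) :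
  finite_dim_subspace Om X S -> subspace S /\ generated S (@ae_null R d Om W).
Proof.
move=> [_ S0 Sl [n [b [Sb gb]]]]; split; first by split.
exists n, b; split=> // f /gb[c fc]; exists c.
by apply: filterS fc => x h /h fx; rewrite -[LHS]/(f x - (\sum_i c i *: b i) x) fx subrr.
Qed.

Lemma component_lin a u v i :
  component (a *: u + v) i = a *: component u i + component v i.
Proof. by apply/funext => x; rewrite /component mxE mxE. Qed.

(** This is the ambient space [H] of the coupled step, which must be closed under combinations; the
    mass form, defined on it, involves no derivatives. *)
Lemma subspace_vec_L2 : subspace (vec (L2 Om)).
Proof.
split=> [i|a u v Lu Lv i]; last by rewrite component_lin; apply: L2_lin.
rewrite (_ : component 0 i = 0); first exact: L2_0.
by apply/funext => x; rewrite /component mxE.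
Qed.

Lemma vec_H10_L2 : H `<=` vec (L2 Om).
Proof. by move=> w Hw i; exact: H10_L2. Qed.

Lemma ae_null_component w i : null w -> ae_eq mu Om (component w i) (cst 0).
Proof. by apply: filterS => x h /h wx; rewrite /component wx mxE. Qed.

Lemma component_operator i :
  L2_operator Om (vec (L2 Om)) null (fun w => component w i).
Proof.
split=> [w|a w z _ _ _|w _ /(ae_null_component i)//]; first exact.
by apply/aeW => x _; rewrite component_lin.
Qed.

Lemma partial_operator i j :
  L2_operator Om H null (fun w => partial Om j (component w i)).
Proof.
split=> [w Hw|a w z Hw Hz Hwz|w Hw Nw].
- exact: H10_L2_partial.
- have := Hwz i; rewrite component_lin => /(partial_lin oOm bOm j (Hw i) (Hz i)).
  by rewrite -component_lin.
- by apply: partial_null => //; exact: ae_null_component.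
Qed.

Lemma eps_operator i j :
  L2_operator Om H null (fun w x => eps Om w x i j).
Proof.
(* The trailing 0 brings the sum into the shape of iterated combinations [c *: A + A']. *)
rewrite (_ : (fun _ => _) = fun w => 2^-1 *: partial Om j (component w i) +
  (2^-1 *: partial Om i (component w j) + 0)).
  apply: L2_operator_lin => //; first exact: partial_operator.
  apply: L2_operator_lin => //; first exact: partial_operator.
  exact: L2_operator_0.
apply/funext => w; apply/funext => x.
rewrite -[RHS]/(2^-1 * partial Om j (component w i) x +
  (2^-1 * partial Om i (component w j) x + 0)).
have -> : eps Om w x i j = 2^-1 *
    (partial Om j (component w i) x + partial Om i (component w j) x).
  by rewrite /eps mxE [in LHS]mxE [in X in _ + X]mxE /grad !mxE.
by move: (partial _ _ _ _) (partial _ _ _ _) => a b; rewrite addr0 mulrDr.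
Qed.

Lemma div_operator : L2_operator Om H null (div Om).
Proof.
rewrite (_ : div Om = fun w => \sum_i partial Om i (component w i)).
  by apply: L2_operator_sum => // i; exact: partial_operator.
apply/funext => w; apply/funext => x; rewrite fct_sumE /div /mxtrace.
by apply: eq_bigr => i _; rewrite mxE.
Qed.

Lemma id_operator : L2_operator Om (L2 Om) null id.
Proof. by split=> // a f g _ _ _; exact: ae_eq_refl. Qed.

Definition mass u z := integral_on Om (fun x => dot (u x) (z x)).

Lemma massE u z : vec (L2 Om) u -> vec (L2 Om) z ->
  mass u z = \sum_i wip Om (cst 1) (component u i) (component z i).
Proof.
move=> Lu Lz; rewrite -integral_on_wip_sum//; last exact: weight_cst.
by congr (integral_on _ _); apply/funext => x; rewrite mul1r.
Qed.

Lemma bilinear_on_mass : bilinear_on (vec (L2 Om)) (vec (L2 Om)) null mass.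
Proof.
apply: bilinear_on_eq massE _; apply: bilinear_on_sum => i.
by apply: bilinear_on_wip => //; [exact: weight_cst|exact: component_operator
  |exact: component_operator].
Qed.

Lemma mass_sym u z : mass u z = mass z u.
Proof.
by congr (integral_on _ _); apply/funext => x; apply: eq_bigr => i _; rewrite mulrC.
Qed.

Lemma mass_ge0 u : 0 <= mass u u.
Proof.
by apply: Rintegral_ge0 => x _; apply: sumr_ge0 => i _; rewrite -expr2 sqr_ge0.
Qed.

(** Each component has norm 0, and finitely many almost everywhere statements hold
    simultaneously. *)
Lemma mass_eq0 u : vec (L2 Om) u -> mass u u = 0 -> null u.
Proof.
move=> Lu; rewrite massE// => /eqP.
rewrite psumr_eq0 => [/allP h|i _]; last by apply: wip_ge0 => x _ /=.
have : \forall x \ae mu, forall i, Om x -> component u i x = 0.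
  apply: filter_forall => i; apply: wip_eq0 => //; apply/eqP.
  by have := h i; rewrite mem_index_enum; exact.
apply: filterS => x h' Ox; apply/rowP => i; rewrite mxE; exact: h'.
Qed.

Lemma ddotE (A B : 'rV[R]_d -> 'M[R]_d) x : ddot (A x) (B x) =
  \sum_(ij : 'I_d * 'I_d) A x ij.1 ij.2 * B x ij.1 ij.2.
Proof. by rewrite /ddot pair_bigA. Qed.

(** The contraction is a finite sum of weighted products over pairs of indices. The weight stands on
    the right to match a division. *)
Lemma bilinear_on_ddot (S : set field) k (A : field -> 'rV[R]_d -> 'M[R]_d) :
  weight Om k -> (forall i j, L2_operator Om S null (fun w x => A w x i j)) ->
  bilinear_on S S null (fun u z => integral_on Om (fun x => ddot (A u x) (A z x) * k x)).
Proof.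
move=> wk hA; apply: (bilinear_on_eq (B' := fun u z => \sum_(ij : 'I_d * 'I_d)
    wip Om k (fun x => A u x ij.1 ij.2) (fun x => A z x ij.1 ij.2))) => [u z Su Sz|].
  rewrite -integral_on_wip_sum//.
  - by congr (integral_on _ _); apply/funext => x; rewrite mulrC ddotE.
  - by move=> [i j]; case: (hA i j) => h _ _; exact: h.
  - by move=> [i j]; case: (hA i j) => h _ _; exact: h.
by apply: bilinear_on_sum => -[i j]; apply: bilinear_on_wip.
Qed.

Lemma ddot_ge0 (A : 'M[R]_d) : 0 <= ddot A A.
Proof.
by apply: sumr_ge0 => i _; apply: sumr_ge0 => j _; rewrite -expr2 sqr_ge0.
Qed.

Lemma bilinear_on_grad : bilinear_on H H null
  (fun v w => integral_on Om (fun x => ddot (grad Om v x) (grad Om w x))).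
Proof.
have := @bilinear_on_ddot H (cst 1) (grad Om) (weight_cst _ _).
rewrite (_ : (fun _ _ => _) = fun v w =>
  integral_on Om (fun x => ddot (grad Om v x) (grad Om w x))).
  apply=> i j; rewrite (_ : (fun _ _ => _) = fun w => partial Om j (component w i)).
    exact: partial_operator.
  by apply/funext => w; apply/funext => x; rewrite mxE.
apply/funext => v; apply/funext => w; congr (integral_on _ _).
by apply/funext => x; rewrite mulr1.
Qed.

Definition pressure (q : scalar) w := integral_on Om (fun x => q x * div Om w x).

Lemma pressureE q w : pressure q w = wip Om (cst 1) q (div Om w).
Proof. by rewrite wip1E. Qed.

Lemma bilinear_on_pressure : bilinear_on (L2 Om) H null pressure.
Proof.
apply: (bilinear_on_eq (B' := fun q w => wip Om (cst 1) q (div Om w))).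
  by move=> q w _ _; exact: pressureE.
by apply: (bilinear_on_wip mOm (weight_cst _ _) id_operator div_operator).
Qed.

(** Commuting the product puts the pressure in the second argument, the one where [bilinear_on]
    kills null vectors. *)
Lemma pressure_null q w : L2 Om q -> H w -> null q -> pressure q w = 0.
Proof.
move=> Lq Hw Nq; rewrite pressureE wipC.
have [_ _ n] := bilinear_on_wip mOm (weight_cst Om 1) div_operator id_operator.
exact: n.
Qed.

(** If [q] had nonzero norm, its supremum would be at most 0 (minus infinity if it runs over the
    empty set), and the infimum could not be [beta > 0]. *)
Lemma inf_sup_injective (X : set field) (Q : set scalar) (beta : R) q :
  0 < beta -> inf_sup Om X Q = beta%:E -> Q q -> L2 Om q ->
  (forall w, X w -> pressure q w = 0) -> null q.
Proof.
move=> beta0 isup Qq Lq pq0; apply: wip_eq0 => //.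
rewrite -normL2_wip; apply/eqP; rewrite sqrf_eq0; apply: contraT => q0.
have : (beta%:E <= 0)%E.
  rewrite -isup; apply: ge_ereal_inf.
  exists (ereal_sup [set (pressure q w / (normL2 Om q * norm_grad Om w))%:E
    | w in [set w | X w /\ norm_grad Om w != 0]]); last first.
    by apply: ge_ereal_sup => _ [w [Xw _] <-]; rewrite pq0// mul0r.
  by exists q.
by rewrite lee_fin leNgt beta0.
Qed.

End forms.

(** This turns each smallness condition into a lower bound for a coefficient, uniform in the
    truncated divergence [t]. *)
Lemma affine_ge {R : realType} (a b t delta : R) : `|t| <= delta ->
  a - `|b| * delta <= a + b * t.
Proof.
move=> td; rewrite lerD2l lerNl; apply: le_trans (ler_norm _) _.
by rewrite normrN normrM ler_wpM2l.
Qed.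

(** * The elastic form with truncated coefficients *)

Section stiffness.
Context {R : realType} (d : nat) (Om : set 'rV[R]_d) (E1 E2 l1 l2 delta : R).
Hypotheses (oOm : open Om) (bOm : bounded_set Om).
Hypotheses (E1_gt0 : 0 < E1) (E2_lt0 : E2 < 0) (delta0 : 0 <= delta)
  (small1 : 0 < 1 - `|l1| * delta)
  (small2 : 0 < gamma3 d E1 E2 - `|gamma4 d E1 E2 l1 l2| * delta)
  (small3 : 0 < 1 - `|l2| * delta).
Variable uold : 'rV[R]_d -> 'rV[R]_d.
Hypothesis Huold : vec (H10 Om) uold.

Local Notation t := (fun x => truncation delta (div Om uold x)).

(** The coefficients are frozen at the divergence of the previous step, which makes the form linear
    in [u]. *)
Definition stiffness (u z : 'rV[R]_d -> 'rV[R]_d) :=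
  E1^-1 * integral_on Om (fun x => ddot (eps Om u x) (eps Om z x) / (1 + l1 * t x)) +
  `|E2| / E1 * integral_on Om (fun x => (1 + l2 * t x) / (1 + l1 * t x) *
    (div Om u x * div Om z x / F d E1 E2 l1 l2 (t x))).

Let mOm : measurable Om. Proof. exact: open_measurable_rV. Qed.

Let t_le x : `|t x| <= delta. Proof. exact: truncation_norm_le. Qed.

Let wt : weight Om t.
Proof.
apply: weight_truncation => //.
by have [h _ _] := div_operator oOm bOm; have [] := h _ Huold.
Qed.

Let lame1_ge x : 1 - `|l1| * delta <= 1 + l1 * t x. Proof. exact: affine_ge. Qed.

Let lame2_ge x : 1 - `|l2| * delta <= 1 + l2 * t x. Proof. exact: affine_ge. Qed.

Let F_ge x : gamma3 d E1 E2 - `|gamma4 d E1 E2 l1 l2| * delta <= F d E1 E2 l1 l2 (t x).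
Proof. by rewrite F_affine//; exact: affine_ge. Qed.

Let lame1_gt0 x : 0 < 1 + l1 * t x. Proof. exact: lt_le_trans (lame1_ge x). Qed.

Let F_gt0 x : 0 < F d E1 E2 l1 l2 (t x). Proof. exact: lt_le_trans (F_ge x). Qed.

(** The three smallness conditions make both denominators and the factor [1 + l2 * t x] positive. *)
Lemma stiffness_ge0 u : 0 <= stiffness u u.
Proof.
apply: addr_ge0; apply: mulr_ge0; rewrite ?invr_ge0 ?divr_ge0 ?(ltW E1_gt0)//.
  apply: Rintegral_ge0 => x _; apply: divr_ge0; first exact: ddot_ge0.
  exact/ltW/lame1_gt0.
apply: Rintegral_ge0 => x _; apply: mulr_ge0; apply: divr_ge0.
- exact: ltW (lt_le_trans small3 (lame2_ge x)).
- exact/ltW/lame1_gt0.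
- by rewrite -expr2 sqr_ge0.
- exact/ltW/F_gt0.
Qed.

(** Positive lower bounds on the denominators make their reciprocals bounded, so that the
    coefficients are weights. *)
Lemma bilinear_on_stiffness :
  bilinear_on (vec (H10 Om)) (vec (H10 Om)) (@ae_null R d Om _) stiffness.
Proof.
have w1 : weight Om (fun x => (1 + l1 * t x)^-1).
  apply: (weight_inv small1); last exact: weight_affine.
  by move=> x _; exact: lame1_ge.
have wF : weight Om (fun x => (F d E1 E2 l1 l2 (t x))^-1).
  apply: (weight_inv small2) => [x _|]; first exact: F_ge.
  rewrite (_ : (fun x => F _ _ _ _ _ _) =
    fun x => gamma3 d E1 E2 + gamma4 d E1 E2 l1 l2 * t x).
    exact: weight_affine.
  by apply/funext => x; rewrite F_affine.
apply: bilinear_on_lin.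
  by apply: bilinear_on_ddot => // i j; exact: eps_operator.
pose k x := (1 + l2 * t x) * (1 + l1 * t x)^-1 * (F d E1 E2 l1 l2 (t x))^-1.
have wk : weight Om k.
  apply: weight_mul wF; apply: weight_mul w1.
  exact: weight_affine.
apply: bilinear_on_eq (bilinear_on_wip mOm wk (div_operator oOm bOm) (div_operator oOm bOm)).
move=> u z _ _; congr (integral_on _ _); apply/funext => x.
by rewrite /k -!mulrA; congr (_ * (_ * _)); rewrite mulrA mulrC.
Qed.

End stiffness.

(** * Unique solvability of one time step *)

Theorem proposition1 (R : realType) (d : nat) (Om : set 'rV[R]_d)
    (T alpha nu rho E1 E2 : R)
    (u0 v0 : 'rV[R]_d -> 'rV[R]_d)
    (lbar D delta lambda1 lambda2 : R)
    (meshes : set R) (U X : R -> set ('rV[R]_d -> 'rV[R]_d))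
    (Q : R -> set ('rV[R]_d -> R)) (beta : R) (N : nat) :
  (d = 2%N \/ d = 3%N) ->
  lipschitz_polytopal_domain Om ->
  0 < T ->
  0 < alpha -> 0 < nu -> 0 < rho ->
  0 < E1 -> E2 < 0 -> 0 < E1 - d%:R * `|E2| ->
  vec (H10 Om) u0 -> V0 Om v0 ->
  0 < lbar -> 0 < D ->
  standing_assumption Om alpha nu rho E1 E2 T lbar D u0 v0 ->
  D <= delta ->
  (forall h, meshes h -> 0 < h /\
    [/\ finite_dim_subspace Om (vec (H10 Om)) (U h),
        finite_dim_subspace Om (vec (H10 Om)) (X h) &
        finite_dim_subspace Om (L20 Om) (Q h)]) ->
  0 < beta ->
  (forall h, meshes h -> inf_sup Om (X h) (Q h) = beta%:E) ->
  (1 < N)%N ->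
  `|lambda1| <= lbar -> `|lambda2| <= lbar ->
  0 < 1 - `|lambda1| * delta ->
  0 < gamma3 d E1 E2 - `|gamma4 d E1 E2 lambda1 lambda2| * delta ->
  0 < 1 - `|lambda2| * delta ->
  forall h, meshes h ->
  forall n : nat, (1 <= n <= N)%N ->
  forall uold vold : 'rV[R]_d -> 'rV[R]_d,
  U h uold -> discretely_div_free Om (X h) (Q h) vold ->
  let system := discrete_system Om alpha nu rho E1 E2 lambda1 lambda2 delta
    (T / N%:R) (U h) (X h) (Q h) uold vold in
  exists u v p, system u v p /\
    forall u' v' p', system u' v' p' ->
      [/\ ae_eq (lebesgue_rV d) Om u' u, ae_eq (lebesgue_rV d) Om v' v &
          ae_eq (lebesgue_rV d) Om p' p].
Proof.
move=> _ [[oOm _ _ bOm] _] T0 alpha0 nu0 rho0 E10 E20 _ _ _ _ D0 _ Ddelta spaces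
  beta0 infsup N1 _ _ small1 small2 small3 h mh n _ uold vold Uuold [Xvold _] system.
have [_ [fU fX fQ]] := spaces h mh.
have [subU genU] := finite_dim_subspaceW fU.
have [subX genX] := finite_dim_subspaceW fX.
have [subQ genQ] := finite_dim_subspaceW fQ.
have [UH _ _ _] := fU; have [XH _ _ _] := fX.
have QL : Q h `<=` L2 Om by case: fQ => QL20 _ _ _ q /QL20[].
have UL : U h `<=` vec (L2 Om) by move=> u /UH; exact: vec_H10_L2.
have XL : X h `<=` vec (L2 Om) by move=> u /XH; exact: vec_H10_L2.
have dt0 : 0 < T / N%:R by rewrite divr_gt0// ltr0n ltnW.
have delta0 : 0 <= delta by apply: le_trans Ddelta; exact: ltW.
pose k := stiffness Om E1 E2 lambda1 lambda2 delta uold.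
pose g (v w : 'rV[R]_d -> 'rV[R]_d) :=
  integral_on Om (fun x => ddot (grad Om v x) (grad Om w x)).
have sysE u v p : system u v p <-> coupled_system (U h) (X h) (Q h) (mass Om) k g
    (pressure Om) alpha rho nu (T / N%:R) uold vold u v p.
  by split=> -[Uu Xv Qp eu ev]; split=> // z Uz;
    [rewrite /k /stiffness addrA; exact: eu|have := eu z Uz; rewrite /k /stiffness addrA].
have [u [v [p [sys uniq]]]] : exists u v p,
    coupled_system (U h) (X h) (Q h) (mass Om) k g
      (pressure Om) alpha rho nu (T / N%:R) uold vold u v p /\
    forall u' v' p', coupled_system (U h) (X h) (Q h) (mass Om) k g
      (pressure Om) alpha rho nu (T / N%:R) uold vold u' v' p' ->
    [/\ ae_null Om (u' - u), ae_null Om (v' - v) & ae_null Om (p' - p)].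
  (* The mass form lives on [vec (L2 Om)]; the forms with derivatives live on [vec (H10 Om)] and are
     restricted to the finite element spaces. *)
  apply: (coupled_system_unique_solution alpha0 rho0 nu0 dt0
    (subspace_vec_L2 oOm) subU subX subQ UL XL genU genX genQ Uuold Xvold).
  - exact: bilinear_on_mass.
  - by move=> x y _ _; exact: mass_sym.
  - by move=> x _; exact: mass_ge0.
  - by move=> x; exact: mass_eq0.
  - by apply: (bilinear_onS UH UH); apply: bilinear_on_stiffness => //; exact: UH.
  - by move=> x _; exact: stiffness_ge0.
  - by apply: (bilinear_onS XH XH); exact: bilinear_on_grad.
  - by move=> x _; apply: Rintegral_ge0 => y _; exact: ddot_ge0.
  - move=> x y _ _; congr (integral_on _ _); apply/funext => z.
    by apply: eq_bigr => i _; apply: eq_bigr => j _; rewrite mulrC.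
  - by apply: (bilinear_onS QL XH); exact: bilinear_on_pressure.
  - by move=> q w Qq Xw; apply: pressure_null => //; [exact: QL|exact: XH].
  - by move=> q Qq; apply: (inf_sup_injective _ beta0 (infsup h mh)) => //; exact: QL.
exists u, v, p; split; first exact/sysE.
have ae_sub (W : lmodType R) (f g' : 'rV[R]_d -> W) :
    ae_null Om (f - g') -> ae_eq (lebesgue_rV d) Om f g'.
  by apply: filterS => x fg /fg /subr0_eq.
by move=> u' v' p' /sysE/uniq[? ? ?]; split; exact: ae_sub.
Qed.
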